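(* Let $m\in\mathbb{N}_0$ and $C_1,\dots,C_m,B_1,\dots,B_m\subseteq\mathbb{CP}^1$. Then $(C_1\times\cdots\times C_m,\;B_1\times\cdots\times B_m)$ is a Grace pair in each of the following cases. (i) For all $k\in\{1,\dots,m\}$, $C_k$ and $B_k$ are projectively convex, $C_k\cup B_k=\mathbb{CP}^1$, and $C_k\cap B_k$ is exactly two points. (ii) For all $k\in\{1,\dots,m\}$, $C_k$ is a closed circular region, $B_k$ is an open circular region, and $C_k\cup B_k=\mathbb{CP}^1$. (iii) For all $k\in\{1,\dots,m\}$, $C_k$ is an open circular region, $B_k$ is a closed circular region, and $C_k\cup B_k=\mathbb{CP}^1$. (iv) $m=1$, $C_1$ and $B_1$ are nonempty and projectively convex, and $C_1\cup B_1=\mathbb{CP}^1$.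
   Context: For $\lambda\in\mathbb{N}_0^m$, $V(\lambda)$ is the complex vector space of polynomials $p(x_1,y_1,\dots,x_m,y_m)$ with complex coefficients that are homogeneous of degree $\lambda_k$ in the pair $(x_k,y_k)$ for each $k$. Points of $\mathbb{CP}^1$ are written $(a:b)$ and identified with the Riemann sphere $\mathbb{C}\cup\{\infty\}$ via $a/b$. Zeros of $p\in V(\lambda)$ are considered in $(\mathbb{CP}^1)^m$. For $\Omega\subseteq(\mathbb{CP}^1)^m$, $p$ is $\Omega$-stable if it has no zero in $\Omega$. Apolarity form: $D^\lambda:V(\lambda)\otimes V(\lambda)\to\mathbb{C}$, $D^\lambda:=\prod_{i=1}^m(\partial_{x_i}\otimes\partial_{y_i}-\partial_{y_i}\otimes\partial_{x_i})^{\lambda_i}$; explicitly $D^\lambda(p\otimes q)=\sum_{\mu\le\lambda}\binom{\lambda}{\mu}(-1)^{|\mu|}(\partial_x^{\lambda-\mu}\partial_y^{\mu}p)(\partial_x^{\mu}\partial_y^{\lambda-\mu}q)$ (multi-index notation). Grace pair: for $S,S'\subseteq(\mathbb{CP}^1)^m$, $(S,S')$ is a Grace pair if for all $\lambda\in\mathbb{N}_0^m$ and all $p,q\in V(\lambda)$ with $p$ $S$-stable and $q$ $S'$-stable one has $D^\lambda(p\otimes q)\ne0$. A circular region in $\mathbb{CP}^1$ is an open or closed disc, half-plane, or complement of a disc, viewed in the Riemann sphere (closed half-planes and complements of discs contain $\infty$); equivalently, an image of the open or closed unit disc under a M\''obius transformation. $\mathrm{SL}_2(\mathbb{C})$ acts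 on $\mathbb{CP}^1$ by M\''obius transformations; the pole of $\phi=\begin{pmatrix}a&b\\c&d\end{pmatrix}$ is $(-d:c)$, the point sent to $\infty$. A set $C\subseteq\mathbb{CP}^1$ is projectively convex if for every $\phi\in\mathrm{SL}_2(\mathbb{C})$ whose pole is not in $C$, the set $\phi\cdot C\subseteq\mathbb{C}$ is convex. *)

(* Defs.v *)
From HB Require Import structures.
From mathcomp Require Import all_boot all_order all_algebra.
From mathcomp Require Import complex mpoly.
From mathcomp Require Import classical_sets reals convex.

Set Implicit Arguments.
Unset Strict Implicit.
Unset Printing Implicit Defensive.

Import Order.TTheory GRing.Theory Num.Theory.

Local Open Scope classical_set_scope.
Local Open Scope ring_scope.
Local Open Scope complex_scope.

(* The complex projective line, as the Riemann sphere: [Some w] is the finite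
   point w = (w : 1) and [None] is oo = (1 : 0). *)
Definition CP1 (R : realType) : Type := option R[i].

(* The point (a : b); only meaningful when (a, b) != (0, 0). *)
Definition hpoint (R : realType) (a b : R[i]) : CP1 R :=
  if b == 0 then None else Some (a / b).

Definition mobius (R : realType) (phi : 'M[R[i]]_2) (z : CP1 R) : CP1 R :=
  if z is Some w
  then hpoint (phi 0 0 * w + phi 0 1) (phi 1 0 * w + phi 1 1)
  else hpoint (phi 0 0) (phi 1 0).

Definition pole (R : realType) (phi : 'M[R[i]]_2) : CP1 R :=
  hpoint (- phi 1 1) (phi 1 0).

(* [Rcomplex R] is R[i] with its structure of real vector space. *)
Definition proj_convex (R : realType) (C : set (CP1 R)) : Prop :=
  forall phi : 'M[R[i]]_2, \det phi = 1 -> ~ C (pole phi) ->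
    convex_set (M := Rcomplex R) (Some @^-1` (mobius phi @` C)).

(* In each case: a disc, a half-plane, or the complement of a disc. *)
Definition closed_circular_region (R : realType) (D : set (CP1 R)) : Prop :=
  [\/ exists (c : R[i]) (r : R),
        0 < r /\ D = Some @` [set w | `|w - c| <= r%:C],
      exists (a : R[i]) (b : R),
        a != 0 /\ D = None |` (Some @` [set w | complex.Re (a * w) <= b])
    | exists (c : R[i]) (r : R),
        0 < r /\ D = ~` (Some @` [set w | `|w - c| < r%:C])].

Definition open_circular_region (R : realType) (D : set (CP1 R)) : Prop :=
  [\/ exists (c : R[i]) (r : R),
        0 < r /\ D = Some @` [set w | `|w - c| < r%:C],
      exists (a : R[i]) (b : R),
        a != 0 /\ D = Some @` [set w | complex.Re (a * w) < b]
    | exists (c : R[i]) (r : R),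
        0 < r /\ D = ~` (Some @` [set w | `|w - c| <= r%:C])].

(* Polynomials in x_1, y_1, ..., x_m, y_m are elements of {mpoly R[i][m + m]}:
   x_k is the variable of index [lshift m k], y_k that of index [rshift m k].
   [xy x y] lists data attached to the x_k and y_k in this indexing. *)
Definition xy (T : Type) (m : nat) (x y : 'I_m -> T) (i : 'I_(m + m)) : T :=
  match split i with inl k => x k | inr k => y k end.

Definition V (R : realType) (m : nat) (lam : 'X_{1..m}) :
    set {mpoly R[i][m + m]} :=
  [set p | forall u : 'X_{1..m + m}, u \in msupp p ->
     forall k : 'I_m, (u (lshift m k) + u (rshift m k) = lam k)%N].

Definition stable (R : realType) (m : nat) (Omega : set ('I_m -> CP1 R))
    (p : {mpoly R[i][m + m]}) : Prop :=
  forall x y : 'I_m -> R[i],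
    (forall k, (x k, y k) != (0, 0)) ->
    Omega (fun k => hpoint (x k) (y k)) ->
    p.@[xy x y] != 0.

Definition dxy (R : realType) (m : nat) (a b : 'X_{1..m})
    (p : {mpoly R[i][m + m]}) : {mpoly R[i][m + m]} :=
  p^`M[ [multinom xy a b i | i < m + m] ].

(* For p, q in V(lam) the polynomial below is constant, every derivative in it
   being one of p or q of multidegree lam; the form is that constant. *)
Definition apolar (R : realType) (m : nat) (lam : 'X_{1..m})
    (p q : {mpoly R[i][m + m]}) : R[i] :=
  (\sum_(mu : 'X_{1..m < (mdeg lam).+1} | (mu <= lam)%MM)
     ((\prod_(k < m) 'C(lam k, mu k))%:R * (-1) ^+ mdeg mu)
       *: (dxy (lam - mu)%MM mu p * dxy mu (lam - mu)%MM q))@_0%MM.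

Definition grace_pair (R : realType) (m : nat) (S S' : set ('I_m -> CP1 R)) :
    Prop :=
  forall (lam : 'X_{1..m}) (p q : {mpoly R[i][m + m]}),
    V lam p -> V lam q -> stable S p -> stable S' q -> apolar lam p q != 0.

Definition cart_prod (T : Type) (m : nat) (C : 'I_m -> set T) :
    set ('I_m -> T) :=
  [set z | forall k, C k (z k)].

(* Main.v *)
(* Call a set of points of the projective line separating if it meets every pair that
   separates two of its points on a circle. Projectively convex sets and circular
   regions are separating, and so are complements of separating sets. Laguerre's
   theorem holds for separating sets: if the form [p] of degree n > 0 has no zero in K,
   neither has its polar derivative with respect to a point of K.

   The apolarity form is obtained by applying lam_k times, for each k, the operator
   Omega_k = d_{x_k} (x) d_{y_k} - d_{y_k} (x) d_{x_k}. Let F = sum_i f_i (x) g_i be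
   multihomogeneous without zeros on (prod K_k) x (prod L_k), where K_k and L_k are
   separating, cover the line and intersect. Laguerre's theorem in both arguments shows
   that the polarization of F in the k-th variables, a bilinear form, has no zero on
   K_k x L_k; hence its antisymmetric part Omega_k F does not vanish, since a symmetric
   form would vanish at a point of both sets and its orthogonal. So every Omega_k
   preserves nonvanishing. This is case (i). In cases (ii) and (iii) the closed regions
   are first enlarged, by compactness, so that they meet the open ones. In case (iv),
   where the sets may be disjoint, one splits off a linear factor of q with zero v in
   C, and the apolarity form of p and q becomes a multiple of that of the polar
   derivative of p at v and of the cofactor. *)

Require Import Defs.
From HB Require Import structures.
From mathcomp Require Import all_boot all_order all_algebra.
From mathcomp Require Import complex ssrcomplements mpoly.
From mathcomp Require Import classical_sets reals convex.
From mathcomp Require Import boolp interval_inference ring lra.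
From mathcomp Require Import topology normedtype derive.

Set Implicit Arguments.
Unset Strict Implicit.
Unset Printing Implicit Defensive.

Import Order.TTheory GRing.Theory Num.Theory.
Import numFieldNormedType.Exports.

Local Open Scope classical_set_scope.
Local Open Scope ring_scope.
Local Open Scope complex_scope.

(** * Separating cones *)

Section Cones.
Variable R : realType.
Local Notation C := R[i].
Implicit Types (u v : C * C) (K : set (C * C)).

Definition wedge u v : C := u.1 * v.2 - u.2 * v.1.

Definition hp u : CP1 R := hpoint u.1 u.2.

Definition cone (D : set (CP1 R)) : set (C * C) := [set u | u != 0 /\ D (hp u)].

(* For independent [u] and [v], the points [u + v] and [u - t v] with [0 < t] are,
   up to rescaling, the pairs of points that separate [u] and [v] on a circle through them.
   A set is projectively convex iff it meets every such pair as soon as it contains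
   [u] and [v]; this condition is visibly stable under complement. *)
Record sep_cone K : Prop := SepCone {
  sep_cone_neq0 : forall u, K u -> u != 0;
  sep_coneZ : forall u (c : C), c != 0 -> K u -> K (c *: u);
  sep_coneP : forall u v (t : R), wedge u v != 0 -> 0 < t -> K u -> K v ->
    K (u + v) \/ K (u - t%:C *: v) }.

Definition coconeC K : set (C * C) := [set u | u != 0 /\ ~ K u].

Lemma wedgeZl c u v : wedge (c *: u) v = c * wedge u v.
Proof. by rewrite /wedge /=; rewrite /GRing.scale /=; ring. Qed.

Lemma wedgeDl u1 u2 v : wedge (u1 + u2) v = wedge u1 v + wedge u2 v.
Proof. by rewrite /wedge /=; ring. Qed.

Lemma wedgeBl u1 u2 v : wedge (u1 - u2) v = wedge u1 v - wedge u2 v.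
Proof. by rewrite /wedge /=; ring. Qed.

Lemma wedgeuu u : wedge u u = 0.
Proof. by rewrite /wedge; ring. Qed.

Lemma wedge0l v : wedge 0 v = 0.
Proof. by rewrite /wedge /=; ring. Qed.

Lemma pair_eq0 u : (u == 0) = (u.1 == 0) && (u.2 == 0).
Proof. by case: u. Qed.

Lemma wedge_colinear u v : u != 0 -> v != 0 -> wedge u v = 0 ->
  exists2 c : C, c != 0 & v = c *: u.
Proof.
rewrite !pair_eq0 !negb_and => u0 v0 uv0.
have [u10|u10] := eqVneq u.1 0.
  move: u0 uv0; rewrite u10 eqxx /wedge u10 mul0r sub0r /= => u20 /eqP.
  rewrite oppr_eq0 mulf_eq0 (negPf u20) /= => /eqP v10.
  move: v0; rewrite v10 eqxx /= => v20.
  exists (v.2 / u.2); first by rewrite mulf_neq0 // invr_eq0.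
  by case: u v u10 u20 v10 v20 => [a b] [c d] /= -> b0 -> d0;
    congr (_, _); rewrite /GRing.scale /= ?mulr0 // divfK.
have e : v.2 = v.1 / u.1 * u.2.
  apply: (mulfI u10); move/eqP: uv0; rewrite subr_eq0 => /eqP ->.
  by field.
exists (v.1 / u.1).
  rewrite mulf_neq0 ?invr_eq0 //; apply: contraTneq v0 => v10.
  by rewrite e v10 !mul0r eqxx.
by case: u v u10 e {u0 v0 uv0} => [a b] [c d] /= a0 ->;
  congr (_, _); rewrite /GRing.scale /= ?divfK.
Qed.

Lemma hpZ c u : c != 0 -> hp (c *: u) = hp u.
Proof.
move=> c0; rewrite /hp /hpoint /= /GRing.scale /= mulf_eq0 (negPf c0) /=.
by case: eqVneq => // u20; congr Some; field; rewrite c0 u20.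
Qed.

Lemma wedge_neq0_addl u v : wedge u v != 0 -> u + v != 0.
Proof.
move=> uv0; apply: contraNneq uv0 => /(congr1 (wedge^~ v)).
by rewrite wedgeDl wedgeuu wedge0l addr0 => ->.
Qed.

Lemma wedge_neq0_subl u v c : wedge u v != 0 -> u - c *: v != 0.
Proof.
move=> uv0; apply: contraNneq uv0 => /(congr1 (wedge^~ v)).
by rewrite wedgeBl wedgeZl wedgeuu wedge0l mulr0 subr0 => ->.
Qed.

(** Separation of pairs is symmetric: for [a = t (u + v)] and [b = u - t v] one has
    [a + b = (1 + t) u] and [a - t b = t (1 + t) v]. So if [K] contained both [u + v] and [u - t v],
    it would contain [u] or [v]. *)
Lemma sep_coneC K : sep_cone K -> sep_cone (coconeC K).
Proof.
move=> [K0 KZ Ks]; split => [u []//|u c c0 [u0 Ku]|u v t uv0 t0 [u0 Ku] [v0 Kv]].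
  split; first by rewrite scaler_eq0 negb_or c0.
  by move=> /(KZ _ c^-1); rewrite invr_eq0 c0 scalerA mulVf // scale1r => /(_ isT).
have tC0 : t%:C != 0 :> C by rewrite fmorph_eq0 /= gt_eqF.
have t1C0 : (1 + t)%:C != 0 :> C by rewrite fmorph_eq0 /= gt_eqF // addr_gt0.
have uv1 : u + v != 0.
  exact: wedge_neq0_addl.
have uv2 : u - t%:C *: v != 0.
  exact: wedge_neq0_subl.
have [K1|K1] := pselect (K (u + v)); last by left.
have [K2|K2] := pselect (K (u - t%:C *: v)); last by right.
exfalso.
have := Ks (t%:C *: (u + v)) (u - t%:C *: v) t _ t0 (KZ _ _ tC0 K1) K2.
have -> : wedge (t%:C *: (u + v)) (u - t%:C *: v) = - (t%:C * (1 + t)%:C) * wedge u v.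
  by rewrite /wedge /= /GRing.scale /= rmorphD rmorph1; ring.
rewrite !mulf_neq0 ?oppr_eq0 ?mulf_neq0 // => /(_ isT).
have -> : t%:C *: (u + v) + (u - t%:C *: v) = (1 + t)%:C *: u.
  by case: u v {u0 v0 uv0 Ku Kv uv1 uv2 K1 K2} => [a b] [c d]; congr (_, _);
    rewrite /= /GRing.scale /= rmorphD rmorph1; ring.
have -> : t%:C *: (u + v) - t%:C *: (u - t%:C *: v) = (t%:C * (1 + t)%:C) *: v.
  by case: u v {u0 v0 uv0 Ku Kv uv1 uv2 K1 K2} => [a b] [c d]; congr (_, _);
    rewrite /= /GRing.scale /= rmorphD rmorph1; ring.
move=> [H|H]; [apply: Ku|apply: Kv].
  by rewrite -[u](scalerK t1C0); apply: KZ H; rewrite invr_eq0.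
have c0 : t%:C * (1 + t)%:C != 0 by rewrite mulf_neq0.
by rewrite -[v](scalerK c0); apply: KZ H; rewrite invr_eq0.
Qed.

(* With [e] sent to infinity this is the convexity of [K]: the [u] in [s] are
   normalized representatives of finite points, and their sum that of the centroid. *)
Lemma sep_cone_centroid K e (s : seq (C * C)) :
  sep_cone K -> ~ K e -> e != 0 -> s != [::] ->
  (forall u, u \in s -> K u) -> (forall u, u \in s -> wedge u e = 1) ->
  K (\sum_(u <- s) u).
Proof.
move=> [K0 KZ Ks] Ke e0.
have main (r : seq (C * C)) v : (forall u, u \in v :: r -> K u) ->
  (forall u, u \in v :: r -> wedge u e = 1) ->
  K (\sum_(u <- v :: r) u) /\ wedge (\sum_(u <- v :: r) u) e = (size r).+1%:R.
  elim: r v => [|u r IH] v Kv we.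
    by rewrite big_seq1; split; [apply: Kv|apply: we]; rewrite mem_head.
  have [||KS wS] := IH u.
  - by move=> x xs; apply: Kv; rewrite inE xs orbT.
  - by move=> x xs; apply: we; rewrite inE xs orbT.
  rewrite big_cons wedgeDl wS we ?mem_head //= -[(size r).+2%:R]nat1r; split => //.
  set S := \sum_(u <- u :: r) u in KS wS *.
  have Kvv : K v by apply: Kv; rewrite mem_head.
  have wv : wedge v e = 1 by apply: we; rewrite mem_head.
  have kC : (size r).+1%:R = ((size r).+1%:R : R)%:C by rewrite rmorph_nat.
  have k0 : (size r).+1%:R != 0 :> C by rewrite pnatr_eq0.
  have [Sv|Sv] := eqVneq (S - (size r).+1%:R *: v) 0.
    have -> : v + S = (size r).+2%:R *: v.
      by move/eqP: Sv; rewrite subr_eq0 => /eqP ->; rewrite -[in RHS]nat1r scalerDl scale1r.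
    by apply: KZ => //; rewrite pnatr_eq0.
  (* [S] and [k v], with [k] the number of points summed in [S], have the same wedge with [e], so
     their nonzero difference is a multiple of [e] and lies outside [K]. The separation condition
     for [S], [v] and [t = k] leaves only [S + v]. *)
  have wSv : wedge (S - (size r).+1%:R *: v) e = 0.
    by rewrite wedgeBl wedgeZl wS wv mulr1 subrr.
  have Kn : ~ K (S - (size r).+1%:R *: v).
    move=> KSv; have [c c0 ec] := wedge_colinear Sv e0 wSv.
    by apply: Ke; rewrite ec; apply: KZ.
  rewrite addrC.
  have [w0|w0] := eqVneq (wedge S v) 0.
    have [c c0 Ev] := wedge_colinear (K0 _ KS) (K0 _ Kvv) w0.
    exfalso; move/eqP: Sv; apply.
    move: wv; rewrite Ev wedgeZl wS => ck.
    by rewrite scalerA mulrC ck scale1r subrr.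
  have t0 : 0 < (size r).+1%:R :> R by rewrite ltr0n.
  by case: (Ks S v _ w0 t0 KS Kvv) => //; rewrite -kC => /Kn.
by case: s => // v s _ Kz wz; apply: (main s v _ _).1.
Qed.

End Cones.

(** * Laguerre's theorem *)

Section BinaryForms.
Variable C : closedFieldType.

(** The formal degree [n] may exceed the degree of [G], the difference being the multiplicity of the
    zero at infinity. The target ring [A] lets one factorization serve for values in [C], along a
    line ([{poly C}]) and for polynomials in several variables. *)
Definition hform (A : comNzRingType) (f : C -> A) (n : nat) (G : {poly C})
    (s t : A) : A := \sum_(j < n.+1) f G`_j * s ^+ j * t ^+ (n - j).

Section Generic.
Variables (A : comNzRingType) (f : {rmorphism C -> A}).
Implicit Types (G H : {poly C}) (s t : A).

Lemma hformD n G H s t :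
  hform f n (G + H) s t = hform f n G s t + hform f n H s t.
Proof.
rewrite /hform -big_split; apply: eq_bigr => j _ /=.
by rewrite coefD rmorphD !mulrDl.
Qed.

Lemma hformZ n c G s t : hform f n (c *: G) s t = f c * hform f n G s t.
Proof.
rewrite /hform big_distrr; apply: eq_bigr => j _ /=.
by rewrite coefZ rmorphM !mulrA.
Qed.

Lemma hform0 n s t : hform f n 0 s t = 0.
Proof. by rewrite /hform big1 // => j _; rewrite coef0 rmorph0 !mul0r. Qed.

Lemma hform_sum n (I : Type) (r : seq I) (F : I -> {poly C}) s t :
  hform f n (\sum_(i <- r) F i) s t = \sum_(i <- r) hform f n (F i) s t.
Proof.
elim: r => [|i r IH]; first by rewrite !big_nil hform0.
by rewrite !big_cons hformD IH.
Qed.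

Lemma hformXn n d s t : (d <= n)%N -> hform f n 'X^d s t = s ^+ d * t ^+ (n - d).
Proof.
move=> dn; have dn1 : (d < n.+1)%N by [].
rewrite /hform (bigD1 (Ordinal dn1)) //= coefXn eqxx rmorph1 mul1r.
rewrite big1 ?addr0 // => j jd; rewrite coefXn.
have -> : (j == d :> nat) = false by apply: negbTE.
by rewrite rmorph0 !mul0r.
Qed.

Lemma hform_mulX n G s t : hform f n.+1 (G * 'X) s t = s * hform f n G s t.
Proof.
rewrite /hform big_ord_recl /= coefMX /= rmorph0 !mul0r add0r big_distrr /=.
apply: eq_bigr => j _; rewrite coefMX /= /bump /= add1n /= subSS exprS.
by ring.
Qed.

Lemma hform_small n G s t :
  (size G <= n.+1)%N -> hform f n.+1 G s t = t * hform f n G s t.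
Proof.
move=> sG; rewrite /hform big_ord_recr /= (nth_default _ sG) rmorph0 !mul0r.
rewrite addr0 [RHS]big_distrr /=; apply: eq_bigr => j _.
have jn : (j <= n)%N by rewrite -ltnS.
by rewrite subSn // exprS; ring.
Qed.

End Generic.

(** If the degree of [G] drops, infinity is a zero and [t] splits off. Otherwise a root [r] of [G]
    does, the cofactor changing sign because the factor is written [r t - s]. *)
Lemma hform_factor n (G : {poly C}) : (size G <= n.+2)%N ->
  exists (z : C * C) (H : {poly C}), [/\ z != 0, (size H <= n.+1)%N &
    forall (A : comNzRingType) (f : {rmorphism C -> A}) (s t : A),
      hform f n.+1 G s t = (f z.1 * t - f z.2 * s) * hform f n H s t].
Proof.
move=> sG; have [sG1|sG1] := leqP (size G) n.+1.
  exists (1, 0), G; split => //; first by rewrite xpair_eqE oner_eq0.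
  by move=> A f s t; rewrite hform_small //= rmorph1 rmorph0; ring.
have eG : size G = n.+2 by apply/eqP; rewrite eqn_leq sG.
have /closed_rootP[r /factor_theorem[H GH]] : size G != 1%N by rewrite eG.
have H0 : H != 0 by apply: contraTneq sG1 => H0; rewrite GH H0 mul0r size_poly0.
have sH : (size H <= n.+1)%N.
  by move: eG; rewrite GH size_Mmonic ?monicXsubC // size_XsubC addn2 /= => -[->].
exists (r, 1), (- H); split; rewrite ?size_polyN //.
  by rewrite xpair_eqE oner_eq0 andbF.
move=> A f s t; rewrite GH mulrBr hformD -mulNr hform_mulX.
have -> : (- H) * r%:P = (- r) *: H by rewrite mulrC mul_polyC scaleNr scalerN.
rewrite hformZ hform_small // -[- H]scaleN1r hformZ !rmorphN !rmorph1 /=.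
by ring.
Qed.

Lemma hform_prod n (G : {poly C}) : (size G <= n.+1)%N ->
  exists (c : C) (zs : seq (C * C)), [/\ size zs = n, all (fun z => z != 0) zs &
    forall (A : comNzRingType) (f : {rmorphism C -> A}) (s t : A),
      hform f n G s t = f c * \prod_(z <- zs) (f z.1 * t - f z.2 * s)].
Proof.
elim: n G => [|n IH] G sG.
  exists G`_0, [::]; split=> // A f s t.
  by rewrite /hform big_ord1 big_nil !expr0 !mulr1.
have [z [H [z0 sH eH]]] := hform_factor sG.
have [c [zs [szs zs0 ezs]]] := IH _ sH.
exists c, (z :: zs); split; rewrite /= ?szs ?z0 // => A f s t.
by rewrite eH ezs big_cons; ring.
Qed.

End BinaryForms.

(** A logarithmic derivative at 0; it will express the polar derivative through the zeros. *)
Lemma coef1_prod_linear (C : fieldType) (I : eqType) (r : seq I) (a b : I -> C) :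
  (forall i, i \in r -> a i != 0) ->
  (\prod_(i <- r) ((a i)%:P + (b i)%:P * 'X))`_1
    = (\prod_(i <- r) a i) * \sum_(i <- r) b i / a i.
Proof.
have E (c d : C) (p : {poly C}) : ((c%:P + d%:P * 'X) * p)`_1 = c * p`_1 + d * p`_0.
  by rewrite mulrDl coefD -mulrA ['X * p]mulrC !mulrA coefCM coefMX /= coefCM.
elim: r => [|i r IH] H; first by rewrite !big_nil mul1r coef1.
have ai : a i != 0 by apply: H; rewrite mem_head.
rewrite !big_cons E.
have E0 : (\prod_(i <- r) ((a i)%:P + (b i)%:P * 'X))`_0 = \prod_(i <- r) a i.
  rewrite -horner_coef0 horner_prod; apply: eq_bigr => j _.
  by rewrite !hornerE.
rewrite IH // => [|j jr]; last by apply: H; rewrite inE jr orbT.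
by rewrite E0; field.
Qed.

Section MultihomogeneousPoints.
Variables (A : Type) (m : nat).

Definition pt (z : 'I_m -> A * A) : 'I_(m + m) -> A :=
  xy (fun k => (z k).1) (fun k => (z k).2).

Definition upd (z : 'I_m -> A * A) (k : 'I_m) (u : A * A) : 'I_m -> A * A :=
  fun j => if j == k then u else z j.

Lemma ptl z k : pt z (lshift m k) = (z k).1.
Proof. by rewrite /pt /xy (unsplitK (inl k)). Qed.

Lemma ptr z k : pt z (rshift m k) = (z k).2.
Proof. by rewrite /pt /xy (unsplitK (inr k)). Qed.

End MultihomogeneousPoints.

Lemma ord_add_ind (m n : nat) (P : 'I_(m + n) -> Prop) :
  (forall k, P (lshift n k)) -> (forall k, P (rshift m k)) -> forall i, P i.
Proof. by move=> Pl Pr i; case: (split_ordP i) => k ->. Qed.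

Section LinePolynomial.
Variables (F : fieldType) (n : nat) (a b : 'I_n -> F).

Definition line_poly (p : {mpoly F[n]}) : {poly F} :=
  mmap polyC (fun i => (a i)%:P + (b i)%:P * 'X) p.

Lemma line_poly_coef0 p : (line_poly p)`_0 = p.@[a].
Proof.
rewrite /line_poly /meval /mmap coef_sum; apply: eq_bigr => u _.
rewrite coefCM /=; congr (_ * _); rewrite /mmap1 -horner_coef0 horner_prod.
by apply: eq_bigr => i _; rewrite !hornerE.
Qed.

(** Both sides are derivations over evaluation at [a]: they satisfy the same product rule and agree
    on constants and variables. *)
Lemma line_poly_coef1 p : (line_poly p)`_1 = \sum_i b i * p^`M(i).@[a].
Proof.
have MP (q r : {mpoly F[n]}) :
  (line_poly q)`_1 = \sum_i b i * q^`M(i).@[a] ->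
  (line_poly r)`_1 = \sum_i b i * r^`M(i).@[a] ->
  (line_poly (q * r))`_1 = \sum_i b i * (q * r)^`M(i).@[a].
  move=> Hq Hr; rewrite /line_poly rmorphM /= -/(line_poly q) -/(line_poly r).
  rewrite coefM big_ord_recl big_ord1 /= /bump /= addn0 subn0 subnn.
  rewrite !line_poly_coef0 Hq Hr mulr_sumr mulr_suml -big_split /=.
  by apply: eq_bigr => i _; rewrite mderivM mevalD !mevalM; ring.
elim/mpolyind: p => [|c u p _ _ IH].
  by rewrite /line_poly mmap0 coef0 big1 // => i _; rewrite mderiv0 meval0 mulr0.
rewrite /line_poly mmapD mmapZ -/(line_poly p) coefD IH coefCM.
under [RHS]eq_bigr do rewrite mderivD mderivZ mevalD mevalZ mulrDr.
rewrite big_split /=; congr (_ + _).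
under eq_bigr do rewrite mulrCA.
rewrite -mulr_sumr; congr (_ * _); rewrite -/(line_poly 'X_[u]).
have H1 : (line_poly 1)`_1 = \sum_i b i * 1^`M(i).@[a].
  rewrite /line_poly rmorph1 coef1 big1 // => i _.
  by rewrite -mpolyC1 mderivC meval0 mulr0.
rewrite mpolyXE_id.
apply: (big_ind (fun q => (line_poly q)`_1 = \sum_i b i * q^`M(i).@[a])) => //.
move=> i _; elim: (u i) => [|d IHd]; first by rewrite expr0.
rewrite exprS; apply: MP => //.
rewrite /line_poly mmapX mmap1U coefD coefC coefMX coefC /= add0r.
rewrite (bigD1 i) //= mderivX mnm1E eqxx scale1r.
have -> : (U_(i) - U_(i) = 0 :> 'X_{1..n})%MM by apply/mnmP => j; rewrite mnmBE subnn mnm0E.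
rewrite mpolyX0 meval1 mulr1 big1 ?addr0 // => j ji.
by rewrite mderivX mnm1E eq_sym (negPf ji) scale0r meval0 mulr0.
Qed.

End LinePolynomial.

Section Restriction.
Variables (R : realType) (m : nat).
Local Notation C := R[i].
Implicit Types (p : {mpoly C[m + m]}) (lam : 'X_{1..m}) (z : 'I_m -> C * C).

Lemma sum_pt_upd k v (d : 'I_(m + m) -> C) :
  \sum_i pt (upd (fun=> 0) k v) i * d i
    = v.1 * d (lshift m k) + v.2 * d (rshift m k).
Proof.
rewrite big_split_ord /= (bigD1 k) //= [X in _ + _ + X](bigD1 k) //=.
rewrite !ptl !ptr /upd eqxx !big1 ?addr0 // => j jk.
  by rewrite ptr (negPf jk) mul0r.
by rewrite ptl (negPf jk) mul0r.
Qed.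

Lemma restrict_hform lam p k z : V lam p ->
  exists2 G : {poly C}, (size G <= (lam k).+1)%N &
    forall (A : comNzRingType) (f : {rmorphism C -> A}) (s t : A),
      mmap f (pt (upd (fun j => (f (z j).1, f (z j).2)) k (s, t))) p
        = hform f (lam k) G s t.
Proof.
move=> Vp.
pose c (u : 'X_{1..m + m}) : C := p@_u * \prod_(j | j != k)
  ((z j).1 ^+ u (lshift m j) * (z j).2 ^+ u (rshift m j)).
exists (\sum_(u <- msupp p) c u *: 'X^(u (lshift m k))).
  rewrite big_seq; apply: (big_ind (fun G : {poly C} => size G <= (lam k).+1)%N).
  - by rewrite size_poly0.
  - by move=> G H sG sH; rewrite (leq_trans (size_polyD _ _)) // geq_max sG.
  move=> u /Vp/(_ k) <-; rewrite (leq_trans (size_scale_leq _ _)) //.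
  by rewrite size_polyXn ltnS leq_addr.
move=> A f s t; rewrite hform_sum /mmap big_seq [RHS]big_seq.
apply: eq_bigr => u /Vp/(_ k) uk.
rewrite hformZ hformXn -?uk ?leq_addr // addKn /c rmorphM -!mulrA; congr (_ * _).
rewrite /mmap1 big_split_ord /= -big_split (bigD1 k) //= mulrC; congr (_ * _).
  rewrite rmorph_prod; apply: eq_bigr => j jk.
  by rewrite ptl ptr /upd (negPf jk) rmorphM !rmorphXn.
by rewrite ptl ptr /upd eqxx.
Qed.

(* Laguerre: if the polar derivative in the direction [v] vanished at [z k], then
   after sending [z k] to infinity [v] would be the centroid of the zeros of [p] in
   the [k]-th variable, all of which lie in the complement of [K k]. *)
Lemma polar_neq0 lam p (K : 'I_m -> set (C * C)) k z v :
  V lam p -> (0 < lam k)%N -> (forall j, sep_cone (K j)) ->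
  (forall y, (forall j, K j (y j)) -> p.@[pt y] != 0) ->
  (forall j, K j (z j)) -> K k v ->
  v.1 * p^`M(lshift m k).@[pt z] + v.2 * p^`M(rshift m k).@[pt z] != 0.
Proof.
move=> Vp lk Ks pK Kz Kv.
have [G sG eG] := restrict_hform k z Vp.
have [c [zs [szs zs0 ezs]]] := hform_prod sG.
have eval u : p.@[pt (upd z k u)] = c * \prod_(x <- zs) wedge x u.
  rewrite -[c]/(idfun c) -[RHS](ezs _ (idfun : {rmorphism C -> C}) u.1 u.2) -eG.
  apply: meval_eq; apply: ord_add_ind => j; rewrite ?ptl ?ptr /upd;
    by case: eqP => //; case: u.
have updz : upd z k (z k) =1 z by move=> j; rewrite /upd; case: eqP => // ->.
have pz : p.@[pt z] = c * \prod_(x <- zs) wedge x (z k).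
  rewrite -eval; apply: meval_eq; apply: ord_add_ind => j;
    by rewrite ?ptl ?ptr updz.
have c0 : c != 0 by apply: contraNneq (pK _ Kz) => c0; rewrite pz c0 mul0r.
have wz x : x \in zs -> wedge x (z k) != 0.
  move=> xzs; apply: contraNneq (pK _ Kz) => wx; rewrite pz.
  by rewrite (big_rem x) //= wx mul0r mulr0.
(* Substituting a zero [x] for the [k]-th point makes [p] vanish, so [x] cannot lie in [K k]. *)
have zsK x : x \in zs -> coconeC (K k) x.
  move=> xzs; split; first exact: (allP zs0).
  move=> Kx; have : p.@[pt (upd z k x)] != 0.
    by apply: pK => j; rewrite /upd; case: eqP => // ->.
  by rewrite eval (big_rem x) //= wedgeuu mul0r mulr0 eqxx.
(* The polar derivative is the linear coefficient of [p] on the line [z k + X v], where each zero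
   [x] contributes the factor [wedge x (z k) + X wedge x v]. *)
pose b i := pt (upd (fun=> 0) k v) i.
have eL : line_poly (pt z) b p
    = c *: \prod_(x <- zs) ((wedge x (z k))%:P + (wedge x v)%:P * 'X).
  have -> : line_poly (pt z) b p = hform polyC (lam k) G
      ((z k).1%:P + v.1%:P * 'X) ((z k).2%:P + v.2%:P * 'X).
    rewrite -eG /line_poly /mmap; apply: eq_bigr => u _; congr (_ * _).
    rewrite /mmap1; apply: eq_bigr => i _; congr (_ ^+ _).
    move: i; apply: ord_add_ind => j; rewrite /b ?ptl ?ptr /upd;
      by case: eqP => [->|] //=; rewrite polyC0 mul0r addr0.
  rewrite ezs -mul_polyC; congr (_ * _); apply: eq_bigr => x _.
  by rewrite /wedge !polyCB !polyCM; ring.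
rewrite -(sum_pt_upd k v (fun i => p^`M(i).@[pt z])) -(line_poly_coef1 _ b).
rewrite eL coefZ coef1_prod_linear //.
rewrite !mulf_neq0 //.
  by rewrite prodf_seq_neq0; apply/allP => x /wz ->.
(* Rescaling each zero to have wedge 1 with [z k] turns the logarithmic derivative into the wedge of
   their sum, the centroid, with [v]. *)
have -> : \sum_(x <- zs) wedge x v / wedge x (z k)
    = wedge (\sum_(x <- zs) (wedge x (z k))^-1 *: x) v.
  elim: (zs) => [|x s IH]; first by rewrite !big_nil wedge0l.
  by rewrite !big_cons wedgeDl wedgeZl IH mulrC.
set S := \sum_(x <- zs) _.
have [_ KZ _] := sep_coneC (Ks k).
have KS : coconeC (K k) S.
  rewrite /S -(big_map (fun x => (wedge x (z k))^-1 *: x) xpredT id).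
  apply: (@sep_cone_centroid _ _ (z k)).
  - exact: sep_coneC.
  - by move=> [].
  - exact: sep_cone_neq0 (Ks k) _ (Kz k).
  - by rewrite -size_eq0 size_map szs -lt0n.
  - by move=> _ /mapP[x xzs ->]; apply: KZ (zsK _ xzs); rewrite invr_eq0 wz.
  - by move=> _ /mapP[x xzs ->]; rewrite wedgeZl mulVf ?wz.
apply/eqP => Sv.
have v0 := sep_cone_neq0 (Ks k) Kv.
have [d d0 ev] := wedge_colinear KS.1 v0 Sv.
by have := KZ _ _ d0 KS; rewrite -ev => -[].
Qed.

End Restriction.

(** * Contraction and the omega process *)

Section Multidegree.
Variables (R : realType) (m : nat).
Local Notation C := R[i].
Implicit Types (p q : {mpoly C[m + m]}) (lam mu : 'X_{1..m}) (u : 'X_{1..m + m}).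

Lemma V0 lam : V lam (0 : {mpoly C[m + m]}).
Proof. by move=> u; rewrite msupp0. Qed.

Lemma VD lam p q : V lam p -> V lam q -> V lam (p + q).
Proof.
by move=> Vp Vq u /msuppD_le; rewrite mem_cat => /orP[/Vp|/Vq].
Qed.

Lemma VZ lam c p : V lam p -> V lam (c *: p).
Proof. by move=> Vp u /msuppZ_le/Vp. Qed.

Lemma V_sum lam (I : eqType) (r : seq I) (F : I -> {mpoly C[m + m]}) :
  (forall i, i \in r -> V lam (F i)) -> V lam (\sum_(i <- r) F i).
Proof.
elim: r => [|i r IH] H; first by rewrite big_nil; exact: V0.
rewrite big_cons; apply: VD; first by apply: H; rewrite mem_head.
by apply: IH => j jr; apply: H; rewrite inE jr orbT.
Qed.

Lemma VM lam mu p q : V lam p -> V mu q -> V (lam + mu)%MM (p * q).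
Proof.
move=> Vp Vq u /msuppM_le /allpairsP[[v w] /= [/Vp vp /Vq wq ->]] k.
by rewrite !mnmDE -vp -wq addnACA.
Qed.

(** Where the subtraction truncates, the derivative is zero and so belongs to every [V]. *)
Lemma V_mderivm lam u p : V lam p ->
  V [multinom lam k - (u (lshift m k) + u (rshift m k)) | k < m] p^`M[u].
Proof.
move=> Vp v; rewrite mcoeff_msupp mcoeff_mderivm => puv k; rewrite mnmE.
have /Vp/(_ k) <- : (u + v)%MM \in msupp p.
  by rewrite mcoeff_msupp; apply: contraNneq puv => ->; rewrite mul0rn.
by rewrite !mnmDE addnACA addKn.
Qed.

Lemma V_const p : V 0%MM p -> p = (p@_0%MM)%:MP.
Proof.
move=> Vp; apply/mpolyP => u; rewrite mcoeffC.
case: eqVneq => [->|u0]; first by rewrite mulr1.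
rewrite mulr0; apply: memN_msupp_eq0; apply: contraNN u0 => /Vp uk.
apply/eqP/mnmP; apply: ord_add_ind => k; move: (uk k) => /eqP;
  by rewrite !mnm0E addn_eq0 => /andP[/eqP ? /eqP].
Qed.

End Multidegree.

Section Contraction.
Variables (R : realType) (m : nat).
Local Notation C := R[i].

(* If [b = c] the form is symmetric; take [u] in both sets and [v] orthogonal to it. *)
Lemma contraction_neq0 (K L : set (C * C)) (a b c d : C) :
  (forall u : C * C, u != 0 -> K u \/ L u) -> (exists u : C * C, [/\ u != 0, K u & L u]) ->
  (forall u v, K u -> L v ->
     a * (u.1 * v.1) + b * (u.1 * v.2) + c * (u.2 * v.1) + d * (u.2 * v.2) != 0) ->
  b - c != 0.
Proof.
move=> KL [u [u0 Ku Lu]] F0; apply/eqP => /eqP; rewrite subr_eq0 => /eqP bc.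
move: F0; rewrite -{c}bc => F0.
pose v := (b * u.1 + d * u.2, - (a * u.1 + b * u.2)).
have [v0|v0] := eqVneq v 0.
  have /eqP := F0 _ _ Ku Lu; case: v0 => v1 /eqP; rewrite oppr_eq0 => /eqP v2.
  case; transitivity (u.1 * (a * u.1 + b * u.2) + u.2 * (b * u.1 + d * u.2)); first by ring.
  by rewrite v1 v2; ring.
case: (KL v v0) => [Kv|Lv].
  by have /eqP := F0 _ _ Kv Lu; rewrite /v /=; case; ring.
by have /eqP := F0 _ _ Ku Lv; rewrite /v /=; case; ring.
Qed.

Variables (K L : 'I_m -> set (C * C)).
Hypotheses (Ksep : forall k, sep_cone (K k)) (Lsep : forall k, sep_cone (L k)).
Hypothesis KL : forall k (u : C * C), u != 0 -> K k u \/ L k u.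
Hypothesis KL0 : forall k, exists u, K k u /\ L k u.

(** With one argument frozen the tensor is a single form, to which Laguerre's theorem applies. Doing
    this in the first argument, then in the second, leaves a bilinear form in two directions [v],
    [v'] without zeros on [K k] times [L k]; the conclusion concerns its antisymmetric part. *)
Lemma tensor_contraction_neq0 (I : eqType) (r : seq I)
    (f g : I -> {mpoly C[m + m]}) lam mu k :
  (forall i, i \in r -> V lam (f i)) -> (forall i, i \in r -> V mu (g i)) ->
  (0 < lam k)%N -> (0 < mu k)%N ->
  (forall z w, (forall j, K j (z j)) -> (forall j, L j (w j)) ->
     \sum_(i <- r) (f i).@[pt z] * (g i).@[pt w] != 0) ->
  forall z w, (forall j, K j (z j)) -> (forall j, L j (w j)) ->
    \sum_(i <- r) (f i)^`M(lshift m k).@[pt z] * (g i)^`M(rshift m k).@[pt w]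
    - \sum_(i <- r) (f i)^`M(rshift m k).@[pt z] * (g i)^`M(lshift m k).@[pt w]
    != 0.
Proof.
move=> Vf Vg lk mk fg z w Kz Lw.
pose D (p : {mpoly C[m + m]}) (y : 'I_m -> C * C) (v : C * C) :=
  v.1 * p^`M(lshift m k).@[pt y] + v.2 * p^`M(rshift m k).@[pt y].
(* Only the linearity in [p] of the derivative at [y] matters below, so this functional is made
   abstract. *)
have dE i (y : 'I_m -> C * C) : exists2 d : {mpoly C[m + m]} -> C,
    (forall p, p^`M(i).@[pt y] = d p) &
    [/\ forall c p, d (c *: p) = c * d p, forall p q, d (p + q) = d p + d q & d 0 = 0].
  exists (fun p => p^`M(i).@[pt y]) => //; split=> [c p|p q|].
  - by rewrite mderivZ mevalZ.
  - by rewrite mderivD mevalD.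
  - by rewrite mderiv0 meval0.
have DZ c (p : {mpoly C[m + m]}) y v : D (c *: p) y v = c * D p y v.
  have [d1 e1 [Z1 _ _]] := dE (lshift m k) y; have [d2 e2 [Z2 _ _]] := dE (rshift m k) y.
  by rewrite /D !(e1, e2) Z1 Z2; ring.
have DS (h : I -> {mpoly C[m + m]}) y v :
  D (\sum_(i <- r) h i) y v = \sum_(i <- r) D (h i) y v.
  have [d1 e1 [_ D1 d10]] := dE (lshift m k) y; have [d2 e2 [_ D2 d20]] := dE (rshift m k) y.
  apply: (big_morph (fun p => D p y v)) => [p q|]; rewrite /D !(e1, e2).
    by rewrite D1 D2; ring.
  by rewrite d10 d20; ring.
have polar1 y v : K k v -> (forall j, L j (y j)) ->
    \sum_(i <- r) (g i).@[pt y] * D (f i) z v != 0.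
  move=> Kv Ly; under eq_bigr do rewrite -DZ.
  rewrite -DS; apply: (@polar_neq0 _ _ lam _ K) => // [|x Kx].
    by apply: V_sum => i ir; apply: VZ; exact: Vf.
  rewrite raddf_sum /=; under eq_bigr do rewrite mevalZ mulrC.
  exact: fg.
have polar2 v v' : K k v -> L k v' ->
    \sum_(i <- r) D (f i) z v * D (g i) w v' != 0.
  move=> Kv Lv; under eq_bigr do rewrite -DZ.
  rewrite -DS; apply: (@polar_neq0 _ _ mu _ L) => // [|x Lx].
    by apply: V_sum => i ir; apply: VZ; exact: Vg.
  rewrite raddf_sum /=; under eq_bigr do rewrite mevalZ mulrC.
  exact: polar1.
pose S i j := \sum_(x <- r) (f x)^`M(i).@[pt z] * (g x)^`M(j).@[pt w].
apply: (@contraction_neq0 (K k) (L k) (S (lshift m k) (lshift m k)) _ _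
         (S (rshift m k) (rshift m k))).
    by move=> u u0; apply: KL.
  by have [u [Ku Lu]] := KL0 k; exists u; split=> //; exact: sep_cone_neq0 Ku.
have expand (f1 f2 g1 g2 : I -> C) (x y x' y' : C) :
    \sum_(i <- r) (x * f1 i + y * f2 i) * (x' * g1 i + y' * g2 i)
    = (\sum_(i <- r) f1 i * g1 i) * (x * x') + (\sum_(i <- r) f1 i * g2 i) * (x * y')
      + (\sum_(i <- r) f2 i * g1 i) * (y * x') + (\sum_(i <- r) f2 i * g2 i) * (y * y').
  by rewrite 4!mulr_suml -3!big_split /=; apply: eq_bigr => i _; ring.
by move=> u v Ku Lv; have := polar2 u v Ku Lv; rewrite /D expand.
Qed.

End Contraction.

Section MonomialFunctionals.
Variables (C : comNzRingType) (n : nat).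
Implicit Types (T : 'X_{1..n} -> C) (Q : {mpoly C[n]}).

(** The linear extension of [T] from monomials. With monomials standing for differential operators,
    it evaluates a polynomial in these operators. *)
Definition mfun T Q : C := \sum_(u <- msupp Q) Q@_u * T u.

(** Replaces the support of [Q] by an index set common to several polynomials, which makes linearity
    in [Q] visible. *)
Lemma mfunE T d Q : (msize Q <= d)%N ->
  mfun T Q = \sum_(u : 'X_{1..n < d}) Q@_u * T u.
Proof.
move=> Qd; pose I : subFinType _ := 'X_{1..n < d}.
rewrite /mfun (big_mksub I) ?msupp_uniq //=; last first.
  by move=> u /msize_mdeg_lt /leq_trans; apply.
by rewrite big_rmcond //= => u /memN_msupp_eq0 ->; rewrite mul0r.
Qed.

Lemma mfunD T Q Q' : mfun T (Q + Q') = mfun T Q + mfun T Q'.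
Proof.
pose d := maxn (msize (Q + Q')) (maxn (msize Q) (msize Q')).
rewrite !(@mfunE T d) /d ?leq_max ?leqnn ?orbT // -big_split.
by apply: eq_bigr => u _; rewrite mcoeffD mulrDl.
Qed.

Lemma mfunZ T c Q : mfun T (c *: Q) = c * mfun T Q.
Proof.
pose d := maxn (msize (c *: Q)) (msize Q).
rewrite !(@mfunE T d) /d ?leq_max ?leqnn ?orbT // mulr_sumr.
by apply: eq_bigr => u _; rewrite mcoeffZ mulrA.
Qed.

Lemma mfun0 T : mfun T 0 = 0.
Proof. by rewrite /mfun msupp0 big_nil. Qed.

Lemma mfun_sum T (I : Type) (r : seq I) (P : pred I) (F : I -> {mpoly C[n]}) :
  mfun T (\sum_(i <- r | P i) F i) = \sum_(i <- r | P i) mfun T (F i).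
Proof. exact: (big_morph _ (mfunD T) (mfun0 T)). Qed.

Lemma mfunX T u : mfun T 'X_[u] = T u.
Proof. by rewrite /mfun msuppX big_seq1 mcoeffX eqxx mul1r. Qed.

Lemma mfunMX T u Q : mfun T (Q * 'X_[u]) = mfun (fun v => T (u + v)%MM) Q.
Proof.
rewrite /mfun (perm_big _ (msuppMX Q u)) big_map.
by apply: eq_bigr => v _; rewrite mcoeffMX.
Qed.

End MonomialFunctionals.

(** * The omega process on pairs of polynomials *)

Section OmegaProcess.
Variables (R : realType) (m : nat).
Local Notation C := R[i].
Implicit Types (p q : {mpoly C[m + m]}) (lam mu : 'X_{1..m}) (u : 'X_{1..m + m}).

Definition swapm u : 'X_{1..m + m} :=
  [multinom xy (fun k => u (rshift m k)) (fun k => u (lshift m k)) i | i < m + m].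

(* The monomial [u] stands for the operator [d^u (x) d^(swapm u)], so that
   d_{x_k} (x) d_{y_k} - d_{y_k} (x) d_{x_k} is ['X_(lshift m k) - 'X_(rshift m k)]. *)
Definition bidiff p q (z w : 'I_m -> C * C) u : C :=
  p^`M[u].@[pt z] * q^`M[swapm u].@[pt w].

Definition omega (k : 'I_m) : {mpoly C[m + m]} := 'X_(lshift m k) - 'X_(rshift m k).

Lemma swapm_lshift u k : swapm u (lshift m k) = u (rshift m k).
Proof. by rewrite /swapm mnmE /xy (unsplitK (inl k)). Qed.

Lemma swapm_rshift u k : swapm u (rshift m k) = u (lshift m k).
Proof. by rewrite /swapm mnmE /xy (unsplitK (inr k)). Qed.

Lemma swapmDl u k : swapm (U_(lshift m k) + u) = (U_(rshift m k) + swapm u)%MM.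
Proof.
apply/mnmP; apply: ord_add_ind => j;
  rewrite mnmDE ?swapm_lshift ?swapm_rshift mnmDE !mnm1E.
  by rewrite eq_lrshift eq_rlshift.
by rewrite eq_lshift eq_rshift.
Qed.

Lemma swapmDr u k : swapm (U_(rshift m k) + u) = (U_(lshift m k) + swapm u)%MM.
Proof.
apply/mnmP; apply: ord_add_ind => j;
  rewrite mnmDE ?swapm_lshift ?swapm_rshift mnmDE !mnm1E.
  by rewrite eq_lshift eq_rshift.
by rewrite eq_lrshift eq_rlshift.
Qed.

Lemma swapm0 : swapm 0%MM = 0%MM.
Proof.
by apply/mnmP; apply: ord_add_ind => j;
  rewrite ?swapm_lshift ?swapm_rshift !mnm0E.
Qed.

(** Multiplying by [omega k] composes operators, and derivatives commute, so the new factor may act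
    on [p] and [q] first. *)
Lemma mfun_omega p q z w k Q :
  mfun (bidiff p q z w) (Q * omega k)
    = mfun (bidiff p^`M(lshift m k) q^`M(rshift m k) z w) Q
    - mfun (bidiff p^`M(rshift m k) q^`M(lshift m k) z w) Q.
Proof.
rewrite /omega mulrBr mfunD.
have -> T Q' : mfun T (- Q') = - mfun T Q' :> C.
  by rewrite -scaleN1r mfunZ mulN1r.
rewrite !mfunMX; congr (_ - _); apply: eq_bigr => v _; congr (_ * _);
  rewrite /bidiff mderivmDm mderivmU1m ?swapmDl ?swapmDr mderivmDm mderivmU1m //.
Qed.

Definition counts (s : seq 'I_m) : 'X_{1..m} := [multinom count_mem k s | k < m].

(** Hence each operator occurring in the product lowers the multidegree of both arguments by
    [counts s]. *)
Lemma V_omega_prod (s : seq 'I_m) : V (counts s) (\prod_(k <- s) omega k).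
Proof.
elim: s => [|k s IH].
  rewrite big_nil => u; rewrite msupp1 inE => /eqP -> k.
  by rewrite !mnm0E.
rewrite big_cons (_ : counts (k :: s) = U_(k) + counts s)%MM; last first.
  by apply/mnmP => j; rewrite mnmDE /counts !mnmE /=.
apply: VM => //; apply: VD; last rewrite -scaleN1r; try apply: VZ;
  move=> u; rewrite msuppX inE => /eqP -> j; rewrite !mnm1E;
  by rewrite ?eq_lshift ?eq_rshift ?eq_lrshift ?eq_rlshift ?addn0.
Qed.

(** Induction on the operators applied: those in [s] produce a tensor with one term [f u (x) g u]
    per monomial [u] of their product, both factors of multidegree [lam - counts s]. One more
    contraction preserves nonvanishing, the bound on counts keeping the degree in the pair [k]
    positive. *)
Lemma mfun_omega_neq0 (K L : 'I_m -> set (C * C)) lam p q (s : seq 'I_m) :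
  (forall k, sep_cone (K k)) -> (forall k, sep_cone (L k)) ->
  (forall k (u : C * C), u != 0 -> K k u \/ L k u) ->
  (forall k, exists u : C * C, K k u /\ L k u) ->
  V lam p -> V lam q ->
  (forall z, (forall k, K k (z k)) -> p.@[pt z] != 0) ->
  (forall z, (forall k, L k (z k)) -> q.@[pt z] != 0) ->
  (forall k, (count_mem k s <= lam k)%N) ->
  forall z w, (forall k, K k (z k)) -> (forall k, L k (w k)) ->
    mfun (bidiff p q z w) (\prod_(k <- s) omega k) != 0.
Proof.
move=> Ks Ls KL KL0 Vp Vq pK qL; elim: s => [|k s IH] sl z w Kz Lw.
  rewrite big_nil -mpolyX0 mfunX /bidiff swapm0 !mderivm0m mulf_neq0 //.
    exact: pK.
  exact: qL.
have sl' j : (count_mem j s <= lam j)%N.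
  by rewrite (leq_trans _ (sl j)) //= leq_addl.
have {}IH := IH sl'.
set Q := \prod_(k <- s) omega k in IH *.
rewrite big_cons -/Q mulrC mfun_omega.
pose f u := Q@_u *: p^`M[u]; pose g u := q^`M[swapm u].
pose mu := [multinom lam j - counts s j | j < m].
have Vf u : u \in msupp Q -> V mu (f u).
  move=> /V_omega_prod uQ; apply: VZ.
  rewrite (_ : mu = [multinom lam k - (u (lshift m k) + u (rshift m k)) | k < m])%MM.
    exact: V_mderivm.
  by apply/mnmP => j; rewrite !mnmE uQ mnmE.
have Vg u : u \in msupp Q -> V mu (g u).
  move=> /V_omega_prod uQ.
  rewrite (_ : mu = [multinom lam k - (swapm u (lshift m k) + swapm u (rshift m k)) | k < m])%MM.
    exact: V_mderivm.
  apply/mnmP => j; rewrite [LHS]mnmE [RHS]mnmE swapm_lshift swapm_rshift addnC.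
  by rewrite uQ.
have muk : (0 < mu k)%N.
  by rewrite /mu /counts !mnmE subn_gt0; have := sl k; rewrite /= eqxx.
have fE y v : \sum_(u <- msupp Q) (f u).@[pt y] * (g u).@[pt v]
    = mfun (bidiff p q y v) Q.
  by apply: eq_bigr => u _; rewrite mevalZ mulrA.
have := @tensor_contraction_neq0 _ _ K L Ks Ls KL KL0 _ (msupp Q) f g mu mu k
  Vf Vg muk muk _ z w Kz Lw.
have H y v : (forall j, K j (y j)) -> (forall j, L j (v j)) ->
    \sum_(u <- msupp Q) (f u).@[pt y] * (g u).@[pt v] != 0.
  by move=> Ky Lv; rewrite fE; exact: IH.
move=> /(_ H).
by congr (_ - _ != 0); apply: eq_bigr => u _;
  rewrite /f /g /bidiff mderivZ mevalZ mulrA -!mderivmU1m -!mderivmDm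
    ![(U_(_) + _)%MM]addmC.
Qed.

End OmegaProcess.

(** * The apolarity form as an iterated omega process *)

Section ApolarExpansion.
Variables (R : realType) (m : nat).
Local Notation C := R[i].
Implicit Types (p q : {mpoly C[m + m]}) (lam mu : 'X_{1..m}).

Definition mxy (a b : 'X_{1..m}) : 'X_{1..m + m} := [multinom xy a b i | i < m + m].

Lemma mxy_lshift a b k : mxy a b (lshift m k) = a k.
Proof. by rewrite /mxy mnmE /xy (unsplitK (inl k)). Qed.

Lemma mxy_rshift a b k : mxy a b (rshift m k) = b k.
Proof. by rewrite /mxy mnmE /xy (unsplitK (inr k)). Qed.

Lemma swapm_mxy a b : swapm (mxy a b) = mxy b a.
Proof.
by apply/mnmP; apply: ord_add_ind => k;
  rewrite ?swapm_lshift ?swapm_rshift mxy_lshift mxy_rshift.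
Qed.

Lemma mpolyX_mxy a b : 'X_[mxy a b] =
  \prod_(k < m) ('X_(lshift m k) ^+ a k * 'X_(rshift m k) ^+ b k) :> {mpoly C[m + m]}.
Proof.
rewrite mpolyXE_id big_split_ord /= -big_split /=.
by apply: eq_bigr => k _; rewrite mxy_lshift mxy_rshift.
Qed.

Lemma lem_mdeg mu lam : (mu <= lam)%MM -> (mdeg mu <= mdeg lam)%N.
Proof. by move/mnm_lepP => le; rewrite !mdegE; apply: leq_sum. Qed.

Lemma mnm_le_mdeg mu k : (mu k <= mdeg mu)%N.
Proof. by rewrite mdegE (bigD1 k) //= leq_addr. Qed.

(** The binomial theorem for each [k], followed by distributivity; the choice of one exponent for
    each [k] is a multi-index [mu <= lam]. *)
Lemma omega_prod_expand lam :
  \prod_(k < m) omega R k ^+ lam k =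
  \sum_(mu : 'X_{1..m < (mdeg lam).+1} | (mu <= lam)%MM)
     ((\prod_(k < m) 'C(lam k, mu k))%:R * (-1) ^+ mdeg mu)
       *: 'X_[mxy (lam - mu) mu].
Proof.
pose N := (mdeg lam).+1.
pose T k i : {mpoly C[m + m]} := ((-1) ^+ i * 'C(lam k, i)%:R)
   *: ('X_(lshift m k) ^+ (lam k - i) * 'X_(rshift m k) ^+ i).
have E k : omega R k ^+ lam k = \sum_(i < N | (i < (lam k).+1)%N) T k i.
  have lN : ((lam k).+1 <= N)%N by rewrite ltnS mnm_le_mdeg.
  rewrite /omega exprBn (big_ord_widen _ (fun i => ((-1) ^+ i
    * 'X_(lshift m k) ^+ (lam k - i) * 'X_(rshift m k) ^+ i) *+ 'C(lam k, i)) lN).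
  apply: eq_bigr => i _; rewrite /T -mul_mpolyC mpolyCM mpolyC_nat.
  by rewrite -[_ *+ _]mulr_natr rmorphXn rmorphN1 /=; ring.
rewrite (eq_bigr _ (fun k _ => E k)) bigA_distr_big_dep.
(* [h] and [h'] identify bounded multi-indices with choice functions. The defaults of [inord] and
   [insubd] are never reached: exponents stay below [N], and a choice bounded by [lam] has total
   degree at most [mdeg lam]. *)
pose h (mu : 'X_{1..m < N}) : {ffun 'I_m -> 'I_N} := [ffun k => inord (mu k)].
pose h' (f : {ffun 'I_m -> 'I_N}) : 'X_{1..m < N} :=
  insubd (@bm0 m _) [multinom (f k : nat) | k < m].
have muN (mu : 'X_{1..m < N}) k : (mu k < N)%N.
  by rewrite (leq_ltn_trans (mnm_le_mdeg _ _)) // bmdeg.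
have hE (mu : 'X_{1..m < N}) k : h mu k = mu k :> nat.
  by rewrite ffunE inordK.
rewrite (reindex_onto h h') /=; last first.
  move=> f /familyP fF; apply/ffunP => k; apply/val_inj.
  rewrite /= hE /h' insubdK ?mnmE //.
  apply: leq_ltn_trans (lem_mdeg (_ : _ <= lam)%MM) _ => //.
  by apply/mnm_lepP => j; rewrite mnmE -ltnS; exact: fF j.
have hh' (mu : 'X_{1..m < N}) : h' (h mu) = mu.
  have e : [multinom (h mu k : nat) | k < m] = mu :> 'X_{1..m}.
    by apply/mnmP => k; rewrite mnmE hE.
  by apply/val_inj; rewrite /h' e insubdK //; exact: bmdeg.
apply: eq_big => [mu|mu _].
  rewrite hh' eqxx andbT; apply/familyP/mnm_lepP => H k; have := H k;
    by rewrite unfold_in hE ltnS.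
rewrite /T; under eq_bigr do rewrite hE.
rewrite scaler_prod big_split /= prodrXr -mdegE natr_prod mulrC.
congr (_ *: _); rewrite mpolyX_mxy.
by apply: eq_bigr => k _; rewrite mnmBE.
Qed.

(** All derivatives involved have the full multidegree [lam], hence are constants: their values at
    [z] and [w] are their constant coefficients. *)
Lemma apolarE lam p q z w : V lam p -> V lam q ->
  apolar lam p q = mfun (bidiff p q z w) (\prod_(k < m) omega R k ^+ lam k).
Proof.
move=> Vp Vq; rewrite omega_prod_expand mfun_sum /apolar raddf_sum /=.
apply: eq_bigr => mu /mnm_lepP mul.
rewrite mcoeffZ mfunZ mfunX; congr (_ * _).
rewrite rmorphM /= /bidiff swapm_mxy.
have cst a b (r : {mpoly C[m + m]}) y : V lam r -> (a + b)%MM = lam ->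
    r^`M[mxy a b].@[pt y] = (dxy a b r)@_0%MM.
  move=> Vr ab; have := @V_mderivm _ _ _ (mxy a b) _ Vr => {}Vr.
  rewrite /dxy -/(mxy a b) [in LHS](V_const (p := r^`M[mxy a b])) ?mevalC //.
  rewrite (_ : 0%MM = [multinom lam k
    - (mxy a b (lshift m k) + mxy a b (rshift m k)) | k < m]%MM) //.
  by apply/mnmP => k; rewrite mnm0E mnmE mxy_lshift mxy_rshift -ab mnmDE subnn.
have e : (lam - mu + mu = lam)%MM by rewrite submK //; apply/mnm_lepP.
by rewrite (cst _ _ _ _ Vp e) (cst _ _ _ _ Vq) // addmC.
Qed.

End ApolarExpansion.

Section CoreGrace.
Variables (R : realType) (m : nat).
Local Notation C := R[i].

Lemma apolar_neq0 (K L : 'I_m -> set (C * C)) lam (p q : {mpoly C[m + m]}) :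
  (forall k, sep_cone (K k)) -> (forall k, sep_cone (L k)) ->
  (forall k (u : C * C), u != 0 -> K k u \/ L k u) ->
  (forall k, exists u : C * C, K k u /\ L k u) ->
  V lam p -> V lam q ->
  (forall z, (forall k, K k (z k)) -> p.@[pt z] != 0) ->
  (forall z, (forall k, L k (z k)) -> q.@[pt z] != 0) ->
  apolar lam p q != 0.
Proof.
move=> Ks Ls KL KL0 Vp Vq pK qL.
(* A point common to [K k] and [L k] serves for evaluation in both arguments. *)
have [z zP] := choice KL0.
rewrite (apolarE z z Vp Vq).
(* Each [k] is listed [lam k] times, which exhausts the degree exactly. *)
pose s := flatten [seq nseq (lam k) k | k <- index_enum 'I_m].
have -> : \prod_(k < m) omega R k ^+ lam k = \prod_(k <- s) omega R k.
  rewrite big_flatten /= big_map; apply: eq_bigr => k _.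
  by rewrite big_nseq; elim: (lam k) => //= n <-; rewrite exprS.
apply: (mfun_omega_neq0 Ks Ls KL KL0 Vp Vq pK qL) => k; last 2 first.
  by case: (zP k).
  by case: (zP k).
rewrite count_flatten -map_comp sumnE big_map (bigD1 k) //=.
rewrite count_nseq /= eqxx mul1n big1 ?addn0 // => j jk.
by rewrite count_nseq /= (negPf jk).
Qed.

End CoreGrace.

(** * One pair of variables *)

(* The commutator of the process [dx (x) dy - dy (x) dx] with multiplication by a
   linear form on the right factor is the polar derivative [a dx + b dy] on the left
   factor, which commutes with the process. *)
Lemma bilinear_process_leibniz (C : comNzRingType) (P : lmodType C)
    (Phi : nat -> P -> P -> C) (dx dy el : P -> P) (l a b : C) :
  (forall p q, Phi 0 p (el q) = l * Phi 0 p q) ->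
  (forall n p q, Phi n.+1 p q = Phi n (dx p) (dy q) - Phi n (dy p) (dx q)) ->
  (forall n p q g, Phi n (p + q) g = Phi n p g + Phi n q g) ->
  (forall n p q g, Phi n g (p + q) = Phi n g p + Phi n g q) ->
  (forall n c p q, Phi n (c *: p) q = c * Phi n p q) ->
  (forall n c p q, Phi n p (c *: q) = c * Phi n p q) ->
  (forall q, dx (el q) = - b *: q + el (dx q)) ->
  (forall q, dy (el q) = a *: q + el (dy q)) ->
  (forall p, dx (dy p) = dy (dx p)) ->
  forall n p q, Phi n p (el q)
    = l * Phi n p q + n%:R * Phi n.-1 (a *: dx p + b *: dy p) q.
Proof.
move=> Phi0 PhiS PhiDl PhiDr PhiZl PhiZr dxe dye dxy.
elim=> [|n IH] p q; first by rewrite mul0r addr0.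
rewrite PhiS dxe dye !PhiDr !PhiZr !IH PhiS /= !PhiDl !PhiZl.
case: n {IH} => [|n]; first by ring.
by rewrite /= !PhiS !dxy -[n.+2%:R]nat1r; ring.
Qed.

Section OmegaBilinear.
Variables (R : realType) (m : nat) (z w : 'I_m -> R[i] * R[i]).
Local Notation C := R[i].
Implicit Types p q g : {mpoly C[m + m]}.

Definition omega_pow k n p q : C := mfun (bidiff p q z w) (omega R k ^+ n).

Lemma omega_pow0 k p q : omega_pow k 0 p q = p.@[pt z] * q.@[pt w].
Proof. by rewrite /omega_pow expr0 -mpolyX0 mfunX /bidiff swapm0 2!mderivm0m. Qed.

Lemma omega_powS k n p q : omega_pow k n.+1 p q
  = omega_pow k n p^`M(lshift m k) q^`M(rshift m k)
  - omega_pow k n p^`M(rshift m k) q^`M(lshift m k).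
Proof. by rewrite /omega_pow exprSr mfun_omega. Qed.

Lemma omega_powDl k n p q g :
  omega_pow k n (p + q) g = omega_pow k n p g + omega_pow k n q g.
Proof.
rewrite /omega_pow /mfun -big_split; apply: eq_bigr => u _ /=.
by rewrite /bidiff mderivmD mevalD mulrDl mulrDr.
Qed.

Lemma omega_powDr k n p q g :
  omega_pow k n g (p + q) = omega_pow k n g p + omega_pow k n g q.
Proof.
rewrite /omega_pow /mfun -big_split; apply: eq_bigr => u _ /=.
by rewrite /bidiff mderivmD mevalD mulrDr mulrDr.
Qed.

Lemma omega_powZl k n c p q : omega_pow k n (c *: p) q = c * omega_pow k n p q.
Proof.
rewrite /omega_pow /mfun mulr_sumr; apply: eq_bigr => u _.
by rewrite /bidiff mderivmZ mevalZ -mulrA mulrCA.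
Qed.

Lemma omega_powZr k n c p q : omega_pow k n p (c *: q) = c * omega_pow k n p q.
Proof.
rewrite /omega_pow /mfun mulr_sumr; apply: eq_bigr => u _.
by rewrite /bidiff mderivmZ mevalZ [_ * (c * _)]mulrCA [LHS]mulrCA.
Qed.

Definition polar k (v : C * C) p :=
  v.1 *: p^`M(lshift m k) + v.2 *: p^`M(rshift m k).

(** This is [wedge v (x_k, y_k)], the linear form vanishing at [v]. *)
Definition lform k (v : C * C) : {mpoly C[m + m]} :=
  v.1 *: 'X_(rshift m k) - v.2 *: 'X_(lshift m k).

Lemma mderiv_lforml k v g :
  (lform k v * g)^`M(lshift m k) = - v.2 *: g + lform k v * g^`M(lshift m k).
Proof.
rewrite mderivM; congr (_ + _); rewrite /lform mderivB 2!mderivZ 2!mderivX 2!mnm1E.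
rewrite eq_rlshift eqxx scale0r scaler0 sub0r scale1r.
have -> : (U_(lshift m k) - U_(lshift m k) = 0 :> 'X_{1..m + m})%MM.
  by apply/mnmP => j; rewrite mnmBE subnn mnm0E.
by rewrite mpolyX0 mulNr -scalerAl mul1r scaleNr.
Qed.

Lemma mderiv_lformr k v g :
  (lform k v * g)^`M(rshift m k) = v.1 *: g + lform k v * g^`M(rshift m k).
Proof.
rewrite mderivM; congr (_ + _); rewrite /lform mderivB 2!mderivZ 2!mderivX 2!mnm1E.
rewrite eq_lrshift eqxx scale0r scaler0 subr0 scale1r.
have -> : (U_(rshift m k) - U_(rshift m k) = 0 :> 'X_{1..m + m})%MM.
  by apply/mnmP => j; rewrite mnmBE subnn mnm0E.
by rewrite mpolyX0 -scalerAl mul1r.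
Qed.

Local Opaque omega_pow mderiv meval.

Lemma omega_pow_lform k v n p g :
  omega_pow k n p (lform k v * g)
    = (lform k v).@[pt w] * omega_pow k n p g
    + n%:R * omega_pow k n.-1 (polar k v p) g.
Proof.
apply: (@bilinear_process_leibniz C {mpoly C[m + m]} (omega_pow k)
  (mderiv (lshift m k)) (mderiv (rshift m k)) (fun q => lform k v * q)).
- by move=> p' q'; rewrite 2!omega_pow0 mevalM mulrCA.
- exact: omega_powS.
- by move=> n' p' q' g'; exact: omega_powDl.
- by move=> n' p' q' g'; exact: omega_powDr.
- by move=> n' c p' q'; exact: omega_powZl.
- by move=> n' c p' q'; exact: omega_powZr.
- exact: mderiv_lforml.
- exact: mderiv_lformr.
- by move=> p'; exact: mderiv_comm.
Qed.

Lemma V_mderiv_lshift lam p k :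
  V lam p -> V [multinom lam j - (j == k) | j < m] p^`M(lshift m k).
Proof.
move=> Vp; rewrite -mderivmU1m.
rewrite (_ : [multinom _ | j < m] = [multinom lam j
  - (U_(lshift m k) (lshift m j) + U_(lshift m k) (rshift m j)) | j < m])%MM.
  exact: V_mderivm.
by apply/mnmP => j; rewrite 2!mnmE 2!mnm1E eq_lshift eq_lrshift addn0 eq_sym.
Qed.

Lemma V_mderiv_rshift lam p k :
  V lam p -> V [multinom lam j - (j == k) | j < m] p^`M(rshift m k).
Proof.
move=> Vp; rewrite -mderivmU1m.
rewrite (_ : [multinom _ | j < m] = [multinom lam j
  - (U_(rshift m k) (lshift m j) + U_(rshift m k) (rshift m j)) | j < m])%MM.
  exact: V_mderivm.
by apply/mnmP => j; rewrite 2!mnmE 2!mnm1E eq_rshift eq_rlshift add0n eq_sym.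
Qed.

End OmegaBilinear.

Section UnivariateGrace.
Variable R : realType.
Local Notation C := R[i].
Implicit Types p q g : {mpoly C[1 + 1]}.
Local Notation k0 := (ord0 : 'I_1).

(** Every term puts [n + 1] derivatives on [g], whose degree is at most [n]. *)
Lemma omega_pow_eq0 z w (lam : 'X_{1..1}) n p g :
  V lam g -> (lam k0 <= n)%N -> omega_pow z w k0 n.+1 p g = 0.
Proof.
elim: n lam p g => [|n IH] lam p g Vg ln.
  have l0 : lam = 0%MM.
    by apply/mnmP => j; rewrite mnm0E (ord1 j); apply/eqP; rewrite -leqn0.
  rewrite (V_const (p := g)) -?l0 // omega_powS 2!mderivC.
  by rewrite 2!omega_pow0 meval0 2!mulr0 subrr.
rewrite omega_powS (IH _ _ _ (V_mderiv_rshift (k := k0) Vg)).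
  rewrite (IH _ _ _ (V_mderiv_lshift (k := k0) Vg)) ?subrr //.
  by rewrite mnmE eqxx leq_subLR add1n.
by rewrite mnmE eqxx leq_subLR add1n.
Qed.

Lemma V_factor lam q n : V lam q -> lam k0 = n.+1 ->
  exists v g, [/\ v != 0, V [multinom n | _ < 1] g & q = lform k0 v * g].
Proof.
move=> Vq ln.
have [G sG eG] := restrict_hform k0 (fun=> 0) Vq; rewrite ln in sG eG.
have [v [H [v0 sH eH]]] := hform_factor sG.
pose X : {mpoly C[1 + 1]} := 'X_(lshift 1 k0); pose Y : {mpoly C[1 + 1]} := 'X_(rshift 1 k0).
(* For [m = 1] nothing is frozen: substituting the variables themselves recovers [q] as a binary
   form in [X] and [Y], and the factorization of forms applies over the polynomial ring. *)
have qE : q = hform (@mpolyC (1 + 1) C) n.+1 G X Y.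
  rewrite -eG -[LHS]comp_mpoly_id /comp_mpoly /mmap; apply: eq_bigr => u _.
  congr (_ * _); rewrite /mmap1; apply: eq_bigr => i _; congr (_ ^+ _).
  rewrite tnth_mktuple; move: i; apply: ord_add_ind => j;
    by rewrite ?ptl ?ptr /upd (ord1 j) eqxx.
exists v, (hform (@mpolyC (1 + 1) C) n H X Y); split => //.
- rewrite /hform; apply: V_sum => j _.
  rewrite -mulrA mul_mpolyC; apply: VZ.
  have := mpolyX_mxy R [multinom (j : nat) | _ < 1] [multinom (n - j)%N | _ < 1].
  rewrite big_ord1 2!mnmE => <- u; rewrite msuppX inE => /eqP -> i.
  by rewrite mxy_lshift mxy_rshift !mnmE subnKC // -ltnS.
- by rewrite qE eH 2!mul_mpolyC.
Qed.

Lemma omega_pow_neq0 (K L : set (C * C)) n (lam : 'X_{1..1}) p q z w :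
  sep_cone K -> (exists u, K u) -> (exists u, L u) ->
  (forall u, L u -> u != 0) -> (forall u : C * C, u != 0 -> K u \/ L u) ->
  V lam p -> V lam q -> lam k0 = n ->
  (forall y, K (y k0) -> p.@[pt y] != 0) ->
  (forall y, L (y k0) -> q.@[pt y] != 0) ->
  omega_pow z w k0 n p q != 0.
Proof.
move=> Ks [a Ka] [b Lb] L0 KL.
elim: n lam p q => [|n IH] lam p q Vp Vq ln pK qL.
  have l0 : lam = 0%MM by apply/mnmP => j; rewrite mnm0E (ord1 j).
  rewrite l0 in Vp Vq; rewrite omega_pow0.
  have := pK (fun=> a) Ka; have := qL (fun=> b) Lb.
  by rewrite (V_const Vp) (V_const Vq) 4!mevalC => q0 p0; rewrite mulf_neq0.
have [v [g [v0 Vg eq]]] := V_factor Vq ln.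
have lv y : (lform k0 v).@[pt y] = wedge v (y k0).
  by rewrite /lform mevalB 2!mevalZ 2!mevalXU ptl ptr.
(* [v] is a zero of [q], so it lies outside [L]. *)
have Kv : K v.
  have [//|Lv] := KL v v0.
  by have := qL (fun=> v) Lv; rewrite eq mevalM lv wedgeuu mul0r eqxx.
have gL y : L (y k0) -> g.@[pt y] != 0.
  by move=> /qL; rewrite eq mevalM mulf_eq0 negb_or => /andP[].
(* In the Leibniz formula the first term vanishes, as [n + 1] processes kill the cofactor [g] of
   degree [n]. There remains [n + 1] times the process of order [n] on the polar derivative of [p]
   at [v] and on [g]. *)
rewrite eq omega_pow_lform (omega_pow_eq0 _ _ _ Vg) ?mnmE // mulr0 add0r /=.
rewrite mulf_neq0 ?pnatr_eq0 //.
have lam' : [multinom lam j - (j == k0) | j < 1] = [multinom n | _ < 1]%MM.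
  by apply/mnmP => j; rewrite 2!mnmE (ord1 j) eqxx ln subn1.
apply: (IH [multinom n | _ < 1]) => //; last 2 first.
- by rewrite mnmE.
- move=> y Ky; rewrite /polar mevalD 2!mevalZ.
  apply: (@polar_neq0 _ _ lam _ (fun=> K)) => //; first by rewrite ln.
  - by move=> x /(_ k0); exact: pK.
  - by move=> j; rewrite (ord1 j).
by rewrite -lam'; apply: VD; apply: VZ;
  [exact: V_mderiv_lshift|exact: V_mderiv_rshift].
Qed.

Lemma apolar1_neq0 (K L : set (C * C)) lam p q :
  sep_cone K -> (exists u, K u) -> (exists u, L u) ->
  (forall u, L u -> u != 0) -> (forall u : C * C, u != 0 -> K u \/ L u) ->
  V lam p -> V lam q ->
  (forall y, K (y k0) -> p.@[pt y] != 0) ->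
  (forall y, L (y k0) -> q.@[pt y] != 0) ->
  apolar lam p q != 0.
Proof.
move=> Ks K1 L1 L0 KL Vp Vq pK qL.
rewrite (apolarE (fun=> 0) (fun=> 0) Vp Vq) big_ord1.
exact: (omega_pow_neq0 _ _ Ks K1 L1 L0 KL Vp Vq erefl pK qL).
Qed.

End UnivariateGrace.

(** * Projectively convex sets and circular regions *)

Section ProjectiveLine.
Variable R : realType.
Local Notation C := R[i].
Implicit Types (u v : C * C) (D : set (CP1 R)).

Lemma hp_surj (d : CP1 R) : exists2 u : C * C, u != 0 & hp u = d.
Proof.
case: d => [x|].
  exists (x, 1); first by rewrite pair_eq0 /= oner_eq0 andbF.
  by rewrite /hp /hpoint /= oner_eq0 divr1.
exists (1, 0); first by rewrite pair_eq0 /= oner_eq0.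
by rewrite /hp /hpoint /= eqxx.
Qed.

Lemma hp_wedge u v : hp u = hp v -> wedge u v = 0.
Proof.
rewrite /hp /hpoint /wedge.
have [->|u2] := eqVneq u.2 0; have [->|v2] := eqVneq v.2 0 => //.
  by rewrite mulr0 mul0r subrr.
by move=> [e]; rewrite -[u.1](divfK u2) e; field.
Qed.

Lemma wedge_hp u v : u != 0 -> v != 0 -> wedge u v = 0 -> hp u = hp v.
Proof. by move=> u0 v0 /(wedge_colinear u0 v0)[c c0 ->]; rewrite hpZ. Qed.

Lemma mobius_hp (phi : 'M[C]_2) u : u != 0 ->
  mobius phi (hp u) = hp (phi 0 0 * u.1 + phi 0 1 * u.2, phi 1 0 * u.1 + phi 1 1 * u.2).
Proof.
case: u => a b; rewrite pair_eq0 negb_and /= => ab.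
have [b0|b0] := eqVneq b 0.
  move: ab; rewrite b0 eqxx orbF => a0.
  rewrite /mobius {1}/hp /hpoint /= eqxx -[RHS](@hpZ _ a^-1) ?invr_eq0 //.
  by rewrite -/(hpoint _ _) /hp /= /GRing.scale /= !mulr0 !addr0 ![a^-1 * _]mulrC !mulfK.
rewrite /mobius {1}/hp {1}/hpoint /= (negPf b0) -[RHS](@hpZ _ b^-1) ?invr_eq0 //.
by rewrite /hp /= /GRing.scale /=; congr hpoint; field.
Qed.

Lemma det2 (phi : 'M[C]_2) : \det phi = phi 0 0 * phi 1 1 - phi 0 1 * phi 1 0.
Proof.
rewrite (expand_det_row _ 0) !big_ord_recl big_ord0 /cofactor !det_mx11 !mxE /=.
rewrite addr0 !addn0 addn1 expr0 expr1 mul1r mulN1r mulrN.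
by congr (_ * phi _ _ - phi _ _ * phi _ _); apply/val_inj.
Qed.

(** If [u + v] is not in [D], a map with pole [u + v] makes the image of [D] convex and sends
    [u - t v] onto the segment joining the images of [u] and [v]. *)
Lemma proj_convex_sep_cone D : proj_convex D -> sep_cone (cone D).
Proof.
move=> Dconv; split => [u []//|u c c0 [u0 Du]|u v t uv0 t0 [u0 Du] [v0 Dv]].
  by split; [rewrite scaler_eq0 negb_or c0|rewrite hpZ].
pose a : C * C := u + v; pose b : C * C := u - t%:C *: v.
have a0 : a != 0.
  exact: wedge_neq0_addl.
have b0 : b != 0.
  exact: wedge_neq0_subl.
have [Da|Da] := pselect (D (hp a)); [by left|right].
split => //.
(* [r] is the first row of a matrix of determinant 1 whose second row is the wedge with [a]. *)
have [r ra] : exists r : C * C, r.1 * a.1 + r.2 * a.2 = 1.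
  move: a0; rewrite pair_eq0 negb_and.
  have [a1|a1 _] := eqVneq a.1 0 => /= [a2|].
    by exists (0, a.2^-1); rewrite /= mul0r add0r mulVf.
  by exists (a.1^-1, 0); rewrite /= mul0r addr0 mulVf.
pose phi : 'M[C]_2 := \matrix_(i, j)
  if i == 0 then (if j == 0 then r.1 else r.2) else (if j == 0 then - a.2 else a.1).
have phiE : (phi 0 0 = r.1) * (phi 0 1 = r.2) * (phi 1 0 = - a.2) * (phi 1 1 = a.1).
  by rewrite !mxE.
have det1 : \det phi = 1 by rewrite det2 !phiE -ra; ring.
have pole_a : pole phi = hp a.
  rewrite -(@hpZ _ (-1)) ?oppr_eq0 ?oner_eq0 // /pole !phiE /hp /= /GRing.scale /=.
  by rewrite !mulN1r.
pose dot (x : C * C) := r.1 * x.1 + r.2 * x.2.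
have mob x : x != 0 -> mobius phi (hp x) = hp (dot x, wedge a x).
  by move=> x0; rewrite mobius_hp // !phiE /wedge; congr (hp (_, _)); ring.
have mobS x : x != 0 -> wedge a x != 0 -> mobius phi (hp x) = Some (dot x / wedge a x).
  by move=> x0 ax; rewrite mob // /hp /hpoint /= (negPf ax).
have wu : wedge a u = - wedge u v by rewrite /wedge /a /=; ring.
have wv : wedge a v = wedge u v by rewrite /wedge /a /=; ring.
have wb : wedge a b = - ((1 + t%:C) * wedge u v).
  by rewrite /wedge /a /b /= /GRing.scale /=; ring.
have t1 : 1 + t != 0 by rewrite gt_eqF // addr_gt0.
have t1C : 1 + t%:C != 0 :> C by rewrite -(rmorph1 (real_complex R)) -rmorphD fmorph_eq0.
have wu0 : wedge a u != 0 by rewrite wu oppr_eq0.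
have wv0 : wedge a v != 0 by rewrite wv.
have wb0 : wedge a b != 0 by rewrite wb oppr_eq0 mulf_neq0.
have l0 : 0 <= (1 + t)^-1 by rewrite invr_ge0 ltW // addr_gt0.
have l1 : (1 + t)^-1 <= 1 by rewrite invf_le1 ?lerDl ?ltW // addr_gt0.
have Dpole : ~ D (pole phi) by rewrite pole_a.
have Du' : (Some @^-1` (mobius phi @` D)) (dot u / wedge a u).
  by exists (hp u) => //; rewrite mobS.
have Dv' : (Some @^-1` (mobius phi @` D)) (dot v / wedge a v).
  by exists (hp v) => //; rewrite mobS.
(* The image of [b] is the combination of those of [u] and [v] with weights [1 / (1 + t)] and
   [t / (1 + t)]. *)
have /set_mem[d Dd] := Dconv phi det1 Dpole _ _ (Itv01 l0 l1) (mem_set Du') (mem_set Dv').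
have scE (s : R) (x : C) : s *: (x : Rcomplex R) = s%:C * x :> C.
  by case: x => x y; simpc.
rewrite /conv /= !scE /unstable.onem => ed.
have {}ed : mobius phi d = mobius phi (hp b).
  rewrite ed mobS //; congr Some; rewrite wu wv wb.
  have -> : dot b = dot u - t%:C * dot v.
    by rewrite /dot /b /= /GRing.scale /=; ring.
  rewrite rmorphB /= fmorphV rmorphD rmorph1 /=.
  by field; rewrite t1C uv0.
have [x x0 xd] := hp_surj d; move: ed; rewrite -xd !mob // => /hp_wedge.
have -> : wedge (dot x, wedge a x) (dot b, wedge a b) = (r.1 * a.1 + r.2 * a.2) * wedge x b.
  by rewrite /wedge /dot /=; ring.
rewrite ra mul1r => /(wedge_hp x0 b0) <-.
by rewrite xd.
Qed.

Lemma stableP m (D : 'I_m -> set (CP1 R)) (p : {mpoly C[m + m]}) :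
  stable (cart_prod D) p <->
  forall z, (forall k, cone (D k) (z k)) -> p.@[pt z] != 0.
Proof.
split=> [st z Dz|H x y xy0 Dxy].
  apply: (st (fun k => (z k).1) (fun k => (z k).2)) => k; have [z0 Dzk] := Dz k;
    [by case: (z k) z0|exact: Dzk].
by apply: (H (fun k => (x k, y k))) => k; split; [exact: xy0|exact: Dxy].
Qed.

End ProjectiveLine.

(** * Circular regions and Hermitian forms *)

Section CircularRegions.
Variable R : realType.
Local Notation C := R[i].
Implicit Types (u v : C * C).

Definition nsq (x : C) : R := complex.Re x ^+ 2 + complex.Im x ^+ 2.

Definition nsq2 u : R := nsq u.1 + nsq u.2.

(* By homogeneity the sign of the Hermitian form [herm A B D] at [u] only depends on
   [hp u]; a circular region is the set of points where such a form is negative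
   (open regions) or nonpositive (closed ones). *)
Definition herm (A : R) (B : C) (D : R) u : R :=
  A * nsq u.1 + complex.Re (B * (u.1 * conjc u.2)) + D * nsq u.2.

Lemma nsq_ge0 x : 0 <= nsq x.
Proof. by rewrite addr_ge0 ?sqr_ge0. Qed.

Lemma nsq_gt0 x : (0 < nsq x) = (x != 0).
Proof.
rewrite lt_neqAle nsq_ge0 andbT eq_sym /nsq paddr_eq0 ?sqr_ge0 // !sqrf_eq0.
by case: x => a b; rewrite eq_complex.
Qed.

Lemma hermZ A B D c u : herm A B D (c *: u) = nsq c * herm A B D u.
Proof.
case: u c B => [[a b] [c d]] [e f] [g h].
by rewrite /herm /nsq /= /GRing.scale /=; ring.
Qed.

Lemma herm_shift A B D e u : herm (A - e) B (D - e) u = herm A B D u - e * nsq2 u.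
Proof. by rewrite /herm /nsq2; ring. Qed.

(** A parallelogram law, weighted so that the cross terms cancel. *)
Lemma herm_parallelogram A B D u v (t : R) :
  t * herm A B D (u + v) + herm A B D (u - t%:C *: v)
    = (1 + t) * herm A B D u + t * (1 + t) * herm A B D v.
Proof.
case: u v B => [[a b] [c d]] [[a' b'] [c' d']] [g h].
by rewrite /herm /nsq /= /GRing.scale /=; ring.
Qed.

(** Were the form nonnegative at both [u + v] and [u - t v], the left side of the parallelogram law
    would be nonnegative and the right side negative. *)
Lemma herm_sep_cone A B D : sep_cone [set u | u != 0 /\ herm A B D u < 0].
Proof.
split => [u []//|u c c0 [u0 Du]|u v t uv0 t0 [u0 Du] [v0 Dv]].
  split; first by rewrite scaler_eq0 negb_or c0.
  by rewrite hermZ pmulr_rlt0 // nsq_gt0.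
have a0 : u + v != 0.
  exact: wedge_neq0_addl.
have b0 : u - t%:C *: v != 0.
  exact: wedge_neq0_subl.
have := herm_parallelogram A B D u v t.
have [|H1] := ltP (herm A B D (u + v)) 0; first by left.
have [|H2 e] := ltP (herm A B D (u - t%:C *: v)) 0; first by right.
have : 0 <= t * herm A B D (u + v) + herm A B D (u - t%:C *: v).
  by rewrite addr_ge0 // mulr_ge0 // ltW.
rewrite e leNgt -oppr_gt0 opprD addr_gt0 //.
  by rewrite oppr_gt0 pmulr_rlt0 // addr_gt0.
by rewrite oppr_gt0 pmulr_rlt0 // mulr_gt0 // addr_gt0.
Qed.

(** [P] is a sign condition. Rescaling multiplies the form by a positive number, so it is enough to
    test the representatives [(1, 0)], where the form is [A], and [(x, 1)]. *)
Lemma herm_hpoint (P : R -> bool) A B D (Z : set (CP1 R)) :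
  (forall c x, 0 < c -> P (c * x) = P x) ->
  (Z None <-> P A) -> (forall x, Z (Some x) <-> P (herm A B D (x, 1))) ->
  forall u, u != 0 -> Z (hp u) <-> P (herm A B D u).
Proof.
move=> PM ZN ZS [a b]; rewrite pair_eq0 negb_and /= /hp /hpoint /=.
have [->|b0 _] := eqVneq b 0.
  rewrite orbF => a0; rewrite ZN (_ : herm A B D (a, 0) = nsq a * A) ?PM ?nsq_gt0 //.
  by case: a B {a0 ZS} => a a' [b' b'']; rewrite /herm /nsq /=; ring.
rewrite ZS (_ : (a, b) = b *: (a / b, 1)); last first.
  by congr (_, _); rewrite /GRing.scale /= ?mulr1 // mulrC divfK.
by rewrite hermZ PM // nsq_gt0.
Qed.

Lemma normc_le (x : C) r : 0 < r -> (`|x| <= r%:C) = (nsq x <= r ^+ 2).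
Proof.
have e : 0 < r -> r = Num.sqrt (r ^+ 2) by move=> r0; rewrite sqrtr_sqr gtr0_norm.
move=> r0; rewrite normc_def lecR {1}(e r0).
by rewrite ler_sqrt // exprn_ge0 ?ltW.
Qed.

Lemma normc_lt (x : C) r : 0 < r -> (`|x| < r%:C) = (nsq x < r ^+ 2).
Proof.
have e : 0 < r -> r = Num.sqrt (r ^+ 2) by move=> r0; rewrite sqrtr_sqr gtr0_norm.
move=> r0; rewrite normc_def ltcR {1}(e r0).
by rewrite ltr_sqrt // exprn_gt0.
Qed.

Let disc_form (c : C) (r : R) x :
  herm 1 (- (2%:R * conjc c)) (nsq c - r ^+ 2) (x, 1) = nsq (x - c) - r ^+ 2.
Proof. by case: x c => a b [c d]; rewrite /herm /nsq /=; ring. Qed.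

Let codisc_form (c : C) (r : R) x :
  herm (-1) (2%:R * conjc c) (r ^+ 2 - nsq c) (x, 1) = r ^+ 2 - nsq (x - c).
Proof. by case: x c => a b [c d]; rewrite /herm /nsq /=; ring. Qed.

Let half_form (a : C) b x : herm 0 a (- b) (x, 1) = complex.Re (a * x) - b.
Proof. by case: x a => x y [c d]; rewrite /herm /nsq /=; ring. Qed.

(** The second half gives points outside the region that an arbitrarily slight enlargement already
    reaches. *)
Lemma closed_circular_herm D : closed_circular_region D ->
  exists A B E, (forall u, u != 0 -> D (hp u) <-> herm A B E u <= 0) /\
    forall d : R, 0 < d -> exists x : C, 0 < herm A B E (x, 1) < d.
Proof.
have PM (c x : R) : 0 < c -> (c * x <= 0) = (x <= 0) by move=> c0; rewrite pmulr_rle0.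
case => [[c [r [r0 ->]]]|[a [b [a0 ->]]]|[c [r [r0 ->]]]].
- exists 1, (- (2%:R * conjc c)), (nsq c - r ^+ 2); split.
    apply: (herm_hpoint (P := fun x : R => x <= 0) PM).
      by split=> [[x _]//|]; rewrite leNgt ltr01.
    move=> x; rewrite disc_form subr_le0 -normc_le //.
    by split=> [[y /= yr [<-]]//|xr]; exists x.
  (* A point just outside the circle, where the form is [d / 2]. *)
  move=> d d0; exists (c + (Num.sqrt (r ^+ 2 + d / 2))%:C).
  rewrite disc_form [c + _]addrC addrK /nsq /= expr0n addr0 sqr_sqrtr; last first.
    by rewrite addr_ge0 ?sqr_ge0 // divr_ge0 // ltW.
  by rewrite addrC addKr; apply/andP; split; lra.
- exists 0, a, (- b); split.
    apply: (herm_hpoint (P := fun x : R => x <= 0) PM).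
      by split=> // _; left.
    move=> x; rewrite half_form subr_le0.
    by split=> [[//|[y /= yr [<-]]//]|xr]; right; exists x.
  move=> d d0; exists ((b + d / 2)%:C / a).
  by rewrite half_form mulrC divfK //= addrC addKr; apply/andP; split; lra.
- exists (-1), (2%:R * conjc c), (r ^+ 2 - nsq c); split.
    apply: (herm_hpoint (P := fun x : R => x <= 0) PM).
      by split=> [_|_ [x]//]; rewrite lerN10.
    move=> x; rewrite codisc_form subr_le0 leNgt -normc_lt //.
    split=> [H|/negP xr [y yr [yx]]]; last by apply: xr; rewrite -yx.
    by apply/negP => xr; apply: H; exists x.
  (* A point of the removed disc where the form is [e]; the cap [r ^+ 2] keeps the argument of the
     square root nonnegative. *)
  move=> d d0; pose e := Num.min (d / 2) (r ^+ 2).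
  have e0 : 0 < e by rewrite lt_min divr_gt0 // exprn_gt0.
  have er : e <= r ^+ 2 by rewrite ge_min lexx orbT.
  have ed : e < d by rewrite gt_min; apply/orP; left; lra.
  exists (c + (Num.sqrt (r ^+ 2 - e))%:C).
  rewrite codisc_form [c + _]addrC addrK /nsq /= expr0n addr0 sqr_sqrtr ?subr_ge0 //.
  by rewrite subKr e0.
Qed.

Lemma open_circular_herm D : open_circular_region D ->
  exists A B E, forall u, u != 0 -> D (hp u) <-> herm A B E u < 0.
Proof.
have PM (c x : R) : 0 < c -> (c * x < 0) = (x < 0) by move=> c0; rewrite pmulr_rlt0.
case => [[c [r [r0 ->]]]|[a [b [a0 ->]]]|[c [r [r0 ->]]]].
- exists 1, (- (2%:R * conjc c)), (nsq c - r ^+ 2).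
  apply: (herm_hpoint (P := fun x : R => x < 0) PM).
    by split=> [[x _]//|]; rewrite ltNge ler01.
  move=> x; rewrite disc_form subr_lt0 -normc_lt //.
  by split=> [[y /= yr [<-]]//|xr]; exists x.
- exists 0, a, (- b).
  apply: (herm_hpoint (P := fun x : R => x < 0) PM).
    by split=> [[x _]//|]; rewrite ltxx.
  move=> x; rewrite half_form subr_lt0.
  by split=> [[y /= yr [<-]]//|xr]; exists x.
- exists (-1), (2%:R * conjc c), (r ^+ 2 - nsq c).
  apply: (herm_hpoint (P := fun x : R => x < 0) PM).
    by split=> [_|_ [x]//]; rewrite ltrN10.
  move=> x; rewrite codisc_form subr_lt0 ltNge -normc_le //.
  split=> [H|/negP xr [y yr [yx]]]; last by apply: xr; rewrite -yx.
  by apply/negP => xr; apply: H; exists x.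
Qed.

End CircularRegions.

(** * Enlarging closed regions *)

Section CompactGap.
Variables (R : realType) (n : nat).
Local Notation X := 'rV[R]_n.

Lemma continuous_addR (f g : X -> R) :
  continuous f -> continuous g -> continuous (fun v => f v + g v).
Proof. by move=> cf cg v; exact: (continuousD (cf v) (cg v)). Qed.

Lemma continuous_mulR (f g : X -> R) :
  continuous f -> continuous g -> continuous (fun v => f v * g v).
Proof. by move=> cf cg v; exact: (continuousM (cf v) (cg v)). Qed.

Lemma continuous_sumR (I : Type) (r : seq I) (f : I -> X -> R) :
  (forall i, continuous (f i)) -> continuous (fun v => \sum_(i <- r) f i v).
Proof.
move=> cf; elim: r => [|i r IH].
  rewrite (_ : (fun v => _) = fun=> 0); first exact: cst_continuous.
  by apply/funext => v; rewrite big_nil.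
rewrite (_ : (fun v => _) = fun v => f i v + \sum_(i <- r) f i v).
  exact: continuous_addR.
by apply/funext => v; rewrite big_cons.
Qed.

(** The sum of the positive parts is continuous and positive on [Z], with a minimum [c > 0]. If all
    [f k v] were below [c / (m + 1)], that sum would be at most [m c / (m + 1) < c]. *)
Lemma compact_gap m (Z : set X) (f : 'I_m -> X -> R) : compact Z ->
  (forall k, continuous (f k)) -> (forall v, Z v -> exists k, 0 < f k v) ->
  exists2 d : R, 0 < d & forall v, Z v -> exists k, d <= f k v.
Proof.
move=> cZ cf f0.
have [Z0|Z0] := pselect (Z !=set0); last first.
  by exists 1 => // v Zv; exfalso; apply: Z0; exists v.
pose g v := \sum_(k < m) Num.max 0 (f k v).
have cg : continuous g.
  apply: continuous_sumR => k v.
  exact: (continuous_max (@cst_continuous _ _ 0 v) (cf k v)).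
have [c /set_mem Zc gc] := compact_EVT_min Z0 cZ (continuous_subspaceT cg).
have g0 : 0 < g c.
  have [k fk] := f0 c Zc; rewrite /g (bigD1 k) //= ltr_pwDl ?lt_max ?fk ?orbT //.
  by apply: sumr_ge0 => j _; rewrite le_max lexx.
have m0 : 0 < m.+1%:R :> R by rewrite ltr0n.
exists (g c / m.+1%:R) => [|v Zv]; first by rewrite divr_gt0.
apply: contrapT => H.
have : g v <= m%:R * (g c / m.+1%:R).
  have e0 : 0 <= g c / m.+1%:R by rewrite ltW // divr_gt0.
  set q := g c / _ in H e0 *.
  rewrite mulr_natl -[in X in _ <= X](card_ord m) -sumr_const; apply: ler_sum => k _.
  rewrite ge_max e0 /= leNgt; apply/negP => fk.
  by apply: H; exists k; rewrite ltW.
rewrite leNgt; apply/negP/negPn; apply: lt_le_trans (gc v (mem_set Zv)).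
by rewrite mulrCA -[ltRHS]mulr1 ltr_pM2l // ltr_pdivrMr // mul1r ltr_nat.
Qed.

Definition ccontinuous (F : X -> R[i]) :=
  continuous (fun v => complex.Re (F v)) /\ continuous (fun v => complex.Im (F v)).

Lemma ccontinuous_cst c : ccontinuous (fun=> c).
Proof. by split=> v; exact: cst_continuous. Qed.

Lemma ccontinuous_mul F G : ccontinuous F -> ccontinuous G ->
  ccontinuous (fun v => F v * G v).
Proof.
move=> [rF iF] [rG iG]; split.
  rewrite (_ : (fun v => _) = fun v => complex.Re (F v) * complex.Re (G v)
      + -1 * (complex.Im (F v) * complex.Im (G v))).
    apply: continuous_addR; first exact: continuous_mulR.
    by apply: continuous_mulR; [exact: cst_continuous|exact: continuous_mulR].
  by apply/funext => v; case: (F v) (G v) => a b [c d] /=; ring.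
rewrite (_ : (fun v => _) = fun v => complex.Re (F v) * complex.Im (G v)
    + complex.Im (F v) * complex.Re (G v)).
  by apply: continuous_addR; exact: continuous_mulR.
by apply/funext => v; case: (F v) (G v) => a b [c d] /=; ring.
Qed.

Lemma ccontinuous_sum (I : Type) (r : seq I) (F : I -> X -> R[i]) :
  (forall i, ccontinuous (F i)) -> ccontinuous (fun v => \sum_(i <- r) F i v).
Proof.
move=> cF; split.
  rewrite (_ : (fun v => _) = fun v => \sum_(i <- r) complex.Re (F i v)).
    by apply: continuous_sumR => i; case: (cF i).
  apply/funext => v; elim: r => [|i r IH]; first by rewrite !big_nil.
  by rewrite !big_cons -IH; case: (F i v) (\sum_(j <- r) _) => a b [c d].
rewrite (_ : (fun v => _) = fun v => \sum_(i <- r) complex.Im (F i v)).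
  by apply: continuous_sumR => i; case: (cF i).
apply/funext => v; elim: r => [|i r IH]; first by rewrite !big_nil.
by rewrite !big_cons -IH; case: (F i v) (\sum_(j <- r) _) => a b [c d].
Qed.

Lemma ccontinuous_prod (I : Type) (r : seq I) (F : I -> X -> R[i]) :
  (forall i, ccontinuous (F i)) -> ccontinuous (fun v => \prod_(i <- r) F i v).
Proof.
move=> cF; elim: r => [|i r IH].
  rewrite (_ : (fun v => _) = fun=> 1); first exact: ccontinuous_cst.
  by apply/funext => v; rewrite big_nil.
rewrite (_ : (fun v => _) = fun v => F i v * \prod_(i <- r) F i v).
  exact: ccontinuous_mul.
by apply/funext => v; rewrite big_cons.
Qed.

Lemma ccontinuous_meval N (w : X -> 'I_N -> R[i]) (p : {mpoly R[i][N]}) :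
  (forall i, ccontinuous (w^~ i)) -> ccontinuous (fun v => p.@[w v]).
Proof.
move=> cw; rewrite (_ : (fun v => _) =
    fun v => \sum_(u <- msupp p) p@_u * \prod_i w v i ^+ u i); last first.
  by apply/funext => v; rewrite mevalE.
apply: ccontinuous_sum => u; apply: ccontinuous_mul; first exact: ccontinuous_cst.
apply: ccontinuous_prod => i; elim: (u i) => [|d IH].
  exact: ccontinuous_cst.
rewrite (_ : (fun v => _) = fun v => w v i * w v i ^+ d).
  exact: ccontinuous_mul.
by apply/funext => v; rewrite exprS.
Qed.

Lemma continuous_nsq F : ccontinuous F -> continuous (fun v => nsq (F v)).
Proof.
by move=> [rF iF]; apply: continuous_addR; apply: continuous_mulR.
Qed.

Lemma continuous_herm A B E (F G : X -> R[i]) : ccontinuous F -> ccontinuous G ->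
  continuous (fun v => herm A B E (F v, G v)).
Proof.
move=> cF cG; apply: continuous_addR; last first.
  by apply: continuous_mulR; [exact: cst_continuous|exact: continuous_nsq].
apply: continuous_addR.
  by apply: continuous_mulR; [exact: cst_continuous|exact: continuous_nsq].
have [] // : ccontinuous (fun v => B * (F v * conjc (G v))).
apply: ccontinuous_mul; first exact: ccontinuous_cst.
apply: ccontinuous_mul => //; case: cG => rG iG; split.
  by rewrite (_ : (fun v => _) = fun v => complex.Re (G v)) //; apply/funext => v; case: (G v).
rewrite (_ : (fun v => _) = fun v => -1 * complex.Im (G v)).
  by apply: continuous_mulR => //; exact: cst_continuous.
by apply/funext => v; case: (G v) => a b /=; rewrite mulN1r.
Qed.

End CompactGap.

Section Enlargement.
Variables (R : realType) (m : nat).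
Local Notation C := R[i].

Lemma meval_pt_scale lam (p : {mpoly C[m + m]}) (c : 'I_m -> C) z : V lam p ->
  p.@[pt (fun k => c k *: z k)] = (\prod_k c k ^+ lam k) * p.@[pt z].
Proof.
move=> Vp; rewrite !mevalE mulr_sumr big_seq [RHS]big_seq.
apply: eq_bigr => u /Vp uE; rewrite mulrCA; congr (_ * _).
rewrite !big_split_ord /= -!big_split /=; apply: eq_bigr => k _.
by rewrite !ptl !ptr /= /GRing.scale /= !exprMn -uE exprD; ring.
Qed.

(** The zeros of [p] whose components all have norm 1 form a compact set, at each point of which one
    of the Hermitian forms is positive. Compactness gives a uniform gap [d], and homogeneity carries
    it to all zeros, since subtracting [d] from [A] and [E] subtracts [d] times the squared norm. *)
Lemma stable_enlarge lam (p : {mpoly C[m + m]}) (A E : 'I_m -> R) (B : 'I_m -> C) :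
  V lam p ->
  (forall z : 'I_m -> C * C, (forall k, z k != 0 /\ herm (A k) (B k) (E k) (z k) <= 0) ->
     p.@[pt z] != 0) ->
  exists2 d : R, 0 < d &
    forall z : 'I_m -> C * C, (forall k, z k != 0 /\ herm (A k - d) (B k) (E k - d) (z k) < 0) ->
      p.@[pt z] != 0.
Proof.
move=> Vp pH.
pose N := ((m + m) + (m + m))%N.
pose w (v : 'rV[R]_N) i : C := v 0 (lshift _ i) +i* v 0 (rshift _ i).
pose y v k := (w v (lshift m k), w v (rshift m k)).
have cw i : ccontinuous (w^~ i) by split; exact: coord_continuous.
have pty v : pt (y v) =1 w v by apply: ord_add_ind => k; rewrite ?ptl ?ptr.
(* [G] vanishes exactly at the normalized zeros of [p], written in real coordinates. *)
pose G v := nsq p.@[w v] + \sum_k (nsq2 (y v k) - 1) ^+ 2.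
have cG : continuous G.
  apply: continuous_addR; first by apply: continuous_nsq; exact: ccontinuous_meval.
  apply: continuous_sumR => k.
  have c2 : continuous (fun v => nsq2 (y v k) - 1).
    apply: continuous_addR; last exact: cst_continuous.
    by apply: continuous_addR; exact: (continuous_nsq (cw _)).
  exact: continuous_mulR.
have G0 v : (G v == 0) = (p.@[w v] == 0) && [forall k, nsq2 (y v k) == 1].
  rewrite paddr_eq0 ?nsq_ge0 ?sumr_ge0 // => [|k _]; last exact: sqr_ge0.
  rewrite -[p.@[_] == 0]negbK -nsq_gt0 lt_neqAle nsq_ge0 andbT eq_sym negbK.
  congr (_ && _); rewrite psumr_eq0 => [|k _]; last exact: sqr_ge0.
  apply/allP/forallP => H k; [have := H k (mem_index_enum k)|have := H k];
    by rewrite sqrf_eq0 subr_eq0.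
(* The box contains all normalized points and provides compactness. *)
pose Z := [set v : 'rV[R]_N | (forall i, `[-1, 1]%classic (v ord0 i)) /\ G v = 0].
have cbox := rV_compact (fun i : 'I_N => @segment_compact R (-1) 1).
have cZ : compact Z.
  apply: (subclosed_compact _ cbox); last by move=> v [].
  apply: closedI.
    exact: (compact_closed (@norm_hausdorff _ _) cbox).
  exact: ((continuous_closedP G).1 cG _ (@closed_eq R 0)).
have [|v [_ /eqP]|d d0 Zd] := @compact_gap R N m Z (fun k v => herm (A k) (B k) (E k) (y v k)) cZ.
- by move=> k; apply: continuous_herm.
- rewrite G0 => /andP[pw /forallP y1]; apply: contrapT => H.
  have yH k : y v k != 0 /\ herm (A k) (B k) (E k) (y v k) <= 0.
    split; last by rewrite leNgt; apply/negP => yk; apply: H; exists k.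
    apply/eqP => yk; have := y1 k; rewrite yk /nsq2 /nsq /= expr0n /= !addr0.
    by rewrite eq_sym oner_eq0.
  by have := pH (y v) yH; rewrite (meval_eq _ (pty v)) pw.
exists d => // z zH; apply/negP => /eqP pz.
have z0 k : 0 < nsq2 (z k).
  have [+ _] := zH k; rewrite pair_eq0 negb_and -!nsq_gt0 => /orP[] h.
    by rewrite ltr_pwDl ?nsq_ge0.
  by rewrite ltr_wpDl ?nsq_ge0.
pose c k := (Num.sqrt (nsq2 (z k)))^-1.
have c2 k : c k ^+ 2 * nsq2 (z k) = 1.
  by rewrite /c exprVn sqr_sqrtr ?ltW // mulVf // gt_eqF.
pose x k := (c k)%:C *: z k.
have nsqC (a : R) : nsq a%:C = a ^+ 2 by rewrite /nsq /= expr0n addr0.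
have nsqM (a b : C) : nsq (a * b) = nsq a * nsq b.
  by case: a b => [a a'] [b b']; rewrite /nsq /=; ring.
have x1 k : nsq2 (x k) = 1.
  by rewrite /x /nsq2 /= /GRing.scale /= !nsqM nsqC -mulrDr c2.
pose X (i : 'I_(m + m)) : C := pt x i.
pose v : 'rV[R]_N := \row_j
  match split j with inl i => complex.Re (X i) | inr i => complex.Im (X i) end.
have wv i : w v i = X i.
  rewrite /w !mxE (unsplitK (inl i)) (unsplitK (inr i)).
  by case: (X i).
have yv k : y v k = x k.
  by rewrite /y !wv /X ptl ptr; case: (x k).
have Zv : Z v.
  split; last first.
    apply/eqP; rewrite G0; apply/andP; split.
      by rewrite (meval_eq _ wv) (meval_pt_scale (fun k => (c k)%:C) z Vp) pz mulr0.
    by apply/forallP => k; rewrite yv x1.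
  have sq1 (a : R) : a ^+ 2 <= 1 -> `[-1, 1]%classic a.
    move=> a1; rewrite /= in_itv /= -ler_norml -(ler_pXn2r (n := 2)) ?nnegrE //.
    by rewrite expr1n real_normK ?num_real.
  have Xi i : nsq (X i) <= 1.
    move: i; apply: ord_add_ind => k; rewrite /X ?ptl ?ptr -(x1 k).
      by rewrite lerDl nsq_ge0.
    by rewrite lerDr nsq_ge0.
  apply: ord_add_ind => i; rewrite mxE; apply: sq1; apply: le_trans (Xi i);
    rewrite ?(unsplitK (inl i)) ?(unsplitK (inr i)).
    by rewrite lerDl sqr_ge0.
  by rewrite lerDr sqr_ge0.
have [k] := Zd v Zv; rewrite yv /x hermZ nsqC leNgt => /negP; apply.
have [_] := zH k; rewrite herm_shift subr_lt0 => h.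
rewrite -[ltRHS]mulr1 -(c2 k) mulrCA ltr_pM2l // /c exprn_gt0 // invr_gt0.
by rewrite sqrtr_gt0.
Qed.

(** A point of [K k] outside [D k] lies in any set that covers the line together with [D k]: this is
    the common point required by [apolar_neq0]. *)
Lemma closed_circular_enlarge (D : 'I_m -> set (CP1 R)) lam (p : {mpoly C[m + m]}) :
  (forall k, closed_circular_region (D k)) -> V lam p -> stable (cart_prod D) p ->
  exists K : 'I_m -> set (C * C), [/\ forall k, sep_cone (K k),
    forall k (u : C * C), u != 0 -> D k (hp u) -> K k u,
    forall k, exists u : C * C, [/\ u != 0, K k u & ~ D k (hp u)] &
    forall z, (forall k, K k (z k)) -> p.@[pt z] != 0].
Proof.
move=> Dc Vp /stableP pD.
have /choice[h hP] : forall k, exists h : R * C * R,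
    (forall u : C * C, u != 0 -> D k (hp u) <-> herm h.1.1 h.1.2 h.2 u <= 0) /\
    forall d : R, 0 < d -> exists x : C, 0 < herm h.1.1 h.1.2 h.2 (x, 1) < d.
  by move=> k; have [A [B [E H]]] := closed_circular_herm (Dc k); exists (A, B, E).
have [|d d0 pd] := @stable_enlarge lam p (fun k => (h k).1.1) (fun k => (h k).2)
  (fun k => (h k).1.2) Vp.
  by move=> z zH; apply: pD => k; have [zk ?] := zH k; split=> //; apply/(hP k).1.
exists (fun k => [set u : C * C | u != 0 /\
  herm ((h k).1.1 - d) (h k).1.2 ((h k).2 - d) u < 0]); split.
- by move=> k; exact: herm_sep_cone.
- move=> k u u0 /(hP k).1 - /(_ u0) hu; split=> //.
  rewrite herm_shift subr_lt0 (le_lt_trans hu) // mulr_gt0 //.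
  move: u0; rewrite pair_eq0 negb_and -!nsq_gt0 => /orP[] u0.
    by rewrite ltr_pwDl ?nsq_ge0.
  by rewrite ltr_wpDl ?nsq_ge0.
- move=> k; have [x /andP[x0 xd]] := (hP k).2 d d0.
  have u0 : (x, 1) != 0 :> C * C by rewrite pair_eq0 /= oner_eq0 andbF.
  exists (x, 1); split=> //; last by move/(hP k).1 => /(_ u0); rewrite leNgt x0.
  (* The form at [(x, 1)] is below [d], and the squared norm there is at least 1. *)
  split=> //; rewrite herm_shift subr_lt0 (lt_le_trans xd) // ler_pMr //.
  by rewrite /nsq2 {2}/nsq /= expr1n expr0n addr0 lerDr nsq_ge0.
- exact: pd.
Qed.

End Enlargement.

(** * The four cases of Grace pairs *)

Section GracePairs.
Variable R : realType.
Local Notation C := R[i].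

Lemma cone_cover (A B : set (CP1 R)) (u : C * C) :
  A `|` B = setT -> u != 0 -> cone A u \/ cone B u.
Proof.
move=> AB u0; have : (A `|` B) (hp u) by rewrite AB.
by case=> [Au|Bu]; [left|right].
Qed.

Lemma cone_nonempty (A : set (CP1 R)) : A !=set0 -> exists u, cone A u.
Proof. by move=> [d Ad]; have [u u0 ud] := hp_surj d; exists u; split; rewrite ?ud. Qed.

Lemma open_circular_sep_cone (A : set (CP1 R)) :
  open_circular_region A -> sep_cone (cone A).
Proof.
move=> /open_circular_herm[a [b [e AH]]].
rewrite (_ : cone A = [set u | u != 0 /\ herm a b e u < 0]).
  exact: herm_sep_cone.
by apply/seteqP; split=> u [u0 /AH Au]; split=> //; exact: Au.
Qed.

Variables (m : nat) (A B : 'I_m -> set (CP1 R)).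

Lemma grace_pair_proj_convex :
  (forall k, [/\ proj_convex (A k), proj_convex (B k), A k `|` B k = setT
    & exists a b : CP1 R, a <> b /\ A k `&` B k = [set a; b]]) ->
  grace_pair (cart_prod A) (cart_prod B).
Proof.
move=> H lam p q Vp Vq /stableP pA /stableP qB.
apply: (apolar_neq0 (K := fun k => cone (A k)) (L := fun k => cone (B k))
  _ _ _ _ Vp Vq pA qB) => [k|k|k u u0|k].
- by have [Ak _ _ _] := H k; exact: proj_convex_sep_cone.
- by have [_ Bk _ _] := H k; exact: proj_convex_sep_cone.
- by have [_ _ AB _] := H k; exact: cone_cover.
have [_ _ _ [a [b [_ AB]]]] := H k.
have [Aa Ba] : (A k `&` B k) a by rewrite AB; left.
by have [u u0 ua] := hp_surj a; exists u; rewrite /cone /= ua.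
Qed.

Lemma grace_pair_closed_open :
  (forall k, [/\ closed_circular_region (A k), open_circular_region (B k)
    & A k `|` B k = setT]) ->
  grace_pair (cart_prod A) (cart_prod B).
Proof.
move=> H lam p q Vp Vq pA /stableP qB.
have Ac k : closed_circular_region (A k) by have [] := H k.
have AB k : A k `|` B k = setT by have [] := H k.
have [K [Ks AK KA pK]] := closed_circular_enlarge Ac Vp pA.
apply: (apolar_neq0 (L := fun k => cone (B k)) Ks _ _ _ Vp Vq pK qB) => [k|k u u0|k].
- by have [_ Bk _] := H k; exact: open_circular_sep_cone.
- by have [[_ Au]|Bu] := cone_cover (AB k) u0; [left; exact: AK|right].
have [u [u0 Ku Au]] := KA k; exists u; split => //.
by case: (cone_cover (AB k) u0) => // -[].
Qed.

Lemma grace_pair_open_closed :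
  (forall k, [/\ open_circular_region (A k), closed_circular_region (B k)
    & A k `|` B k = setT]) ->
  grace_pair (cart_prod A) (cart_prod B).
Proof.
move=> H lam p q Vp Vq /stableP pA qB.
have Bc k : closed_circular_region (B k) by have [] := H k.
have AB k : A k `|` B k = setT by have [] := H k.
have [L [Ls BL LB qL]] := closed_circular_enlarge Bc Vq qB.
apply: (apolar_neq0 (K := fun k => cone (A k)) _ Ls _ _ Vp Vq pA qL) => [k|k u u0|k].
- by have [Ak _ _] := H k; exact: open_circular_sep_cone.
- by have [Au|[_ Bu]] := cone_cover (AB k) u0; [left|right; exact: BL].
have [u [u0 Lu Bu]] := LB k; exists u; split => //.
by case: (cone_cover (AB k) u0) => // -[].
Qed.

End GracePairs.

Lemma grace_pair_univariate (R : realType) (A B : 'I_1 -> set (CP1 R)) :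
  (forall k, [/\ A k !=set0, B k !=set0, proj_convex (A k), proj_convex (B k)
    & A k `|` B k = setT]) ->
  grace_pair (cart_prod A) (cart_prod B).
Proof.
move=> H lam p q Vp Vq /stableP pA /stableP qB.
have [A0 B0 Ac _ AB] := H ord0.
apply: (apolar1_neq0 (K := cone (A ord0)) (L := cone (B ord0))) Vp Vq _ _.
- exact: proj_convex_sep_cone.
- exact: cone_nonempty.
- exact: cone_nonempty.
- by move=> u [].
- by move=> u; exact: cone_cover.
- by move=> y Ay; apply: pA => k; rewrite (ord1 k).
- by move=> y By; apply: qB => k; rewrite (ord1 k).
Qed.

Theorem theorem5p7 (R : realType) (m : nat) (C B : 'I_m -> set (CP1 R)) :
  [/\ (* (i) *)
      (forall k,
         [/\ proj_convex (C k), proj_convex (B k), C k `|` B k = setT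
           & exists a b : CP1 R, a <> b /\ C k `&` B k = [set a; b]]) ->
      grace_pair (cart_prod C) (cart_prod B),
      (* (ii) *)
      (forall k,
         [/\ closed_circular_region (C k), open_circular_region (B k)
           & C k `|` B k = setT]) ->
      grace_pair (cart_prod C) (cart_prod B),
      (* (iii) *)
      (forall k,
         [/\ open_circular_region (C k), closed_circular_region (B k)
           & C k `|` B k = setT]) ->
      grace_pair (cart_prod C) (cart_prod B)
    & (* (iv) *)
      m = 1%N ->
      (forall k,
         [/\ C k !=set0, B k !=set0, proj_convex (C k), proj_convex (B k)
           & C k `|` B k = setT]) ->
      grace_pair (cart_prod C) (cart_prod B)].
Proof.
split=> [H|H|H|m1 H].
- exact: grace_pair_proj_convex.
- exact: grace_pair_closed_open.
- exact: grace_pair_open_closed.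
- by subst m; exact: grace_pair_univariate.
Qed.
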